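(* Let $\mathcal{P}$ be a bounded distribution (as defined in the context) and let $\bm{\pi}_{\mathrm{bounded}}$ be the online policy (Algorithm 1) described in the context, run with parameter $C=9$. Then $\bm{\pi}_{\mathrm{bounded}}$ is a feasible online policy and $$\mathrm{Regret}_{\mathcal{P}}(\bm{\pi}_{\mathrm{bounded}})=\widetilde{\mathcal{O}}(\sqrt{T}),$$ i.e., the regret is at most $\sqrt{T}$ times a factor polylogarithmic in $T$, with constants that do not depend on $T$.
   Context: Online linear programming with replenishment. There are $m$ resources and a horizon $T$. Tuples $(r_t,\bm{a}_t,\bm{b}_t)\in\mathbb{R}\times\mathbb{R}^m\times\mathbb{R}^m_{\geq 0}$, $t=1,\dots,T$, are drawn i.i.d. from an unknown distribution $\mathcal{P}$. Inventory of every resource starts at $0$. In period $t$ each resource $j$ is first replenished by $b_{jt}$; then the order $(r_t,\bm{a}_t)$ is revealed and the decision maker chooses $x_t\in\{0,1\}$ (possibly at random) based only on $(r_k,\bm{a}_k,\bm{b}_k,x_k)_{k<t}$ and $(r_t,\bm{a}_t,\bm{b}_t)$; accepting earns $r_t$ and consumes $\bm{a}_t$ (negative entries mean restocking). A policy is feasible if for every realization, $\sum_{k=1}^t a_{jk}x_k\le\sum_{k=1}^t b_{jk}$ for all $j\in[m]$, $t\in[T]$. The hindsight optimum $R^*$ is the maximum of $\sum_{t=1}^T r_tx_t$ over $\bm{x}\in\{0,1\}^T$ subject to these prefix constraints, and $\mathrm{Regret}_{\mathcal{P}}(\bm{\pi})=\mathbb{E}_{\mathcal{P}}[R^*-\sum_{t=1}^T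 r_tx_t]$ where $x_t$ are the decisions of $\bm{\pi}$. Bounded distribution: there are constants $\bar r,\bar a,\bar b>0$ with $|r|<\bar r$, $\|\bm{a}\|_2<\bar a$, $\|\bm{b}\|_\infty<\bar b$ almost surely, and $\underline{b}>0$ with $\mathbb{E}[b_j]>\underline{b}$ for all $j\in[m]$. Algorithm 1 (inputs $\bar r,\bar a,\bar b,\underline b,T$, and a parameter $C>0$): set $W=2+\left\lceil\max\left(\frac{8\sqrt m\bar r}{\underline b},\frac{24\sqrt m(\bar b+\bar a)\bar b^2}{\underline b^2},\frac{\bar r+2m(\bar b^2+\bar a^2)}{\sqrt m(\bar b+\bar a)}\right)\right\rceil$ and $\kappa=\lceil 4W\sqrt{CT\ln T}/\underline b\rceil$. Initialize $p^1_j=0$, $\ell_{j,1}=0$ for all $j$. For $t=1,\dots,T$: observe $(r_t,\bm a_t,\bm b_t)$. If $t\le\kappa$, set $x_t=0$ and $p^{t+1}_j=0$ for all $j$. Otherwise set $x_t=\mathbb{I}(\forall j\in[m],\ \ell_{j,t}\ge a_{jt})\cdot\mathbb{I}(r_t>\langle\bm p^t,\bm a_t\rangle)$ and $p^{t+1}_j=\left[p^t_j-\frac{1}{\sqrt{CT\ln T}}\left(b_{jt}-a_{jt}\mathbb{I}(r_t>\langle\bm p^t,\bm a_t\rangle)\right)\right]^+$ for all $j$. Finally set $\ell_{j,t+1}=\ell_{j,t}+b_{jt}-a_{jt}x_t$ for all $j$. Here $[y]^+=\max(y,0)$. *)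

(* Defs.v *)
From HB Require Import structures.
From mathcomp Require Import all_boot all_order all_algebra.
From mathcomp Require Import all_classical all_reals all_analysis.
Set Implicit Arguments. Unset Strict Implicit. Unset Printing Implicit Defensive.
Import Order.TTheory GRing.Theory Num.Theory.
Local Open Scope classical_set_scope.
Local Open Scope ring_scope.

(* Data of period t (t = 1..T):  r t : R,  a t j, b t j : R  (j : 'I_m). *)

Section Algo.
Variables (R : realType) (m : nat).
Variables (rbar abar bbar blow : R) (T : nat) (C : R).

Definition alg_W : R :=
  2 + (Num.ceil (Num.max (8 * Num.sqrt m%:R * rbar / blow)
     (Num.max (24 * Num.sqrt m%:R * (bbar + abar) * bbar ^+ 2 / blow ^+ 2)
              ((rbar + 2 * m%:R * (bbar ^+ 2 + abar ^+ 2))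
                 / (Num.sqrt m%:R * (bbar + abar))))))%:~R.

Definition alg_kappa : R :=
  (Num.ceil (4 * alg_W * Num.sqrt (C * T%:R * ln T%:R) / blow))%:~R.

Definition alg_eta : R := (Num.sqrt (C * T%:R * ln T%:R))^-1.

Variables (r : nat -> R) (a b : nat -> 'I_m -> R).

Definition inner (p : 'I_m -> R) (t : nat) : R := \sum_(j < m) p j * a t j.

(* decision x_t given the state (p^t, l_{.,t}) at the start of period t *)
Definition alg_dec (t : nat) (st : ('I_m -> R) * ('I_m -> R)) : bool :=
  if t%:R <= alg_kappa then false
  else [forall j, a t j <= st.2 j] && (inner st.1 t < r t).

Definition alg_step (t : nat) (st : ('I_m -> R) * ('I_m -> R))
  : ('I_m -> R) * ('I_m -> R) :=
  let x := alg_dec t st in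
  let acc : bool := inner st.1 t < r t in
  let p' := if t%:R <= alg_kappa then (fun _ => 0)
            else (fun j => Num.max (st.1 j - alg_eta *
                     (b t j - a t j * acc%:R)) 0) in
  (p', fun j => st.2 j + b t j - a t j * x%:R).

(* alg_state n = (p^{n+1}, l_{.,n+1}), the state at the start of period n+1 *)
Fixpoint alg_state (n : nat) : ('I_m -> R) * ('I_m -> R) :=
  match n with
  | 0 => (fun _ => 0, fun _ => 0)
  | n'.+1 => alg_step n (alg_state n')
  end.

Definition alg_x (t : nat) : bool := alg_dec t (alg_state t.-1).

Definition feasible (x : 'I_T -> bool) : Prop :=
  forall (j : 'I_m) (t : 'I_T),
    \sum_(k < T | (k <= t)%N) a k.+1 j * (x k)%:R
      <= \sum_(k < T | (k <= t)%N) b k.+1 j.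

Definition reward (x : 'I_T -> bool) : R := \sum_(k < T) r k.+1 * (x k)%:R.

(* hindsight optimum R^* (x = 0 is feasible when b >= 0, so max >= 0) *)
Definition hindsight_opt : R :=
  \big[Num.max/0]_(x : {ffun 'I_T -> bool} | `[< feasible x >]) reward x.

Definition alg_reward : R := \sum_(k < T) r k.+1 * (alg_x k.+1)%:R.

Definition alg_feasible : Prop := feasible (fun k => alg_x k.+1).

End Algo.

Definition rect_event {Omega R : Type} {m : nat} (r : Omega -> R) (a b : 'I_m -> Omega -> R)
  (A0 : set R) (A B : 'I_m -> set R) : set Omega :=
  [set w | A0 (r w) /\ (forall j, A j (a j w)) /\ (forall j, B j (b j w))].

Section Prob.
Local Open Scope ereal_scope.
Context {d : measure_display} {Omega : measurableType d} {R : realType}.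
Variables (P : probability Omega R) (m : nat).

Definition same_law {d2 : measure_display} {Omega2 : measurableType d2}
  (P2 : probability Omega2 R)
  (r1 : Omega -> R) (a1 b1 : 'I_m -> Omega -> R)
  (r2 : Omega2 -> R) (a2 b2 : 'I_m -> Omega2 -> R) : Prop :=
  forall (A0 : set R) (A B : 'I_m -> set R),
    measurable A0 -> (forall j, measurable (A j)) -> (forall j, measurable (B j)) ->
    P (rect_event r1 a1 b1 A0 A B) = P2 (rect_event r2 a2 b2 A0 A B).

Definition mutually_independent (T : nat) (r : nat -> Omega -> R)
  (a b : nat -> 'I_m -> Omega -> R) : Prop :=
  forall (S : {set 'I_T}) (A0 : 'I_T -> set R) (A B : 'I_T -> 'I_m -> set R),
    (forall t, measurable (A0 t)) -> (forall t j, measurable (A t j)) ->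
    (forall t j, measurable (B t j)) ->
    P (\bigcap_(t in [set t | t \in S])
         rect_event (r t.+1) (a t.+1) (b t.+1) (A0 t) (A t) (B t))
    = \prod_(t in S) P (rect_event (r t.+1) (a t.+1) (b t.+1) (A0 t) (A t) (B t)).

Definition bounded_draw (rbar abar bbar blow : R) (r : Omega -> R)
  (a b : 'I_m -> Omega -> R) : Prop :=
  [/\ measurable_fun setT r, (forall j, measurable_fun setT (a j)) &
      (forall j, measurable_fun setT (b j))] /\
  {ae P, forall w, (forall j, (0 <= b j w)%R)} /\
  {ae P, forall w, (`|r w| < rbar)%R} /\
  {ae P, forall w, (Num.sqrt (\sum_(j < m) a j w ^+ 2) < abar)%R} /\
  {ae P, forall w, (forall j, (`|b j w| < bbar)%R)} /\
  (forall j, (\int[P]_w (b j w)%:E) > blow%:E).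

End Prob.

(* Main.v *)
Require Import Defs.
From HB Require Import structures.
From mathcomp Require Import all_boot all_order all_algebra.
From mathcomp Require Import all_classical all_reals all_analysis.
From mathcomp Require Import measurable_realfun ring lra zify.
Import Order.TTheory GRing.Theory Num.Theory.
Local Open Scope classical_set_scope.
Local Open Scope ring_scope.

(* Write f_t(p) = (r_t - <p, a_t>)^+ + <p, b_t>, and let y_t = [r_t > <p^t, a_t>] be
   the decision of the algorithm when inventory is ignored.
   Weak duality for the last prefix constraint gives R^* <= sum_t f_t(q) for every
   fixed q >= 0, while r_t y_t = f_t(p^t) - <p^t, g_t> for the subgradient
   g_t = b_t - a_t y_t, and the projected step bounds sum_t <p^t, g_t> by eta T G^2 / 2.
   As p^t is independent of the draw of period t, E f_t(p^t) >= inf_p E f(p). Hence the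
   regret is at most the loss of the warm-up, plus O(eta T), plus rbar times the
   expected number of periods with y_t = 1 in which the inventory check fails.
   Such stockouts are exponentially rare. Before the first one,
   eta l_t >= eta l_(kappa+1) - p^t; the norm of p^t has negative drift above a
   threshold of order rbar / blow, so exp(s |p^t| / eta) has moderate expectation, and
   the same exponential moment of the b_t controls the warm-up inventory. *)

Set Implicit Arguments.
Unset Strict Implicit.
Unset Printing Implicit Defensive.

(** * Finite product spaces and independence *)

(** Taking [lambda = s / eta] separates two scales. The exponent gained in one period is
    [lambda * eta = s], free of [T], so a single [mgf_rate] gives a factor of mean at most 1 in
    every period. Against a fixed gap in scaled price or inventory, however, the moments lose
    [exp (- lambda)] with [lambda >= s * sqrt T], which beats the [T ^ 3] coming from crude union
    bounds. [W] is the common unit of these gaps. Prices drift down above [theta <= W / 2] and are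
    compared with [W]. The warm-up has about [4 * W / (eta * blow)] periods; counted at half the
    mean rate it yields [2 * W] of scaled stock, while [3 / 2 * W] suffices: [W] for the price to
    trade against, [W / 2] for one order. No conditional expectation is formed: the state is a
    function of a history vector whose joint law with the next draw is a product, and Tonelli does
    the rest. Since only integrals of nonnegative functions are used, inequalities are arranged
    without subtraction under the integral. The dual infimum need not be attained, so a minimizer up
    to [1 / T] is used. Horizons too short for the step size to be small are charged to a
    constant. *)

Definition boxes (R : realType) (I : finType) : set (set (I -> R)) :=
  [set B | exists2 A : I -> set R, (forall i, measurable (A i)) &
                                   B = [set x | forall i, A i (x i)]].

(* An alias of [I -> R], which has no canonical pointed structure for R : realType. *)
Definition fun_space (R : realType) (I : finType) : Type := I -> R.

HB.instance Definition _ R I := gen_eqMixin (fun_space R I).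
HB.instance Definition _ R I := gen_choiceMixin (fun_space R I).
HB.instance Definition _ R I := isPointed.Build (fun_space R I) (fun=> 0).

Notation fspace R I :=
  (g_sigma_algebraType (@boxes R I : set (set (fun_space R I)))).

Section FiniteProductSpace.
Variables (R : realType) (I : finType).
Local Notation boxes := (@boxes R I).
Local Notation fspace := (fspace R I).

Lemma boxes_setI_closed : setI_closed boxes.
Proof.
move=> _ _ [A mA ->] [B mB ->]; exists (fun i => A i `&` B i).
  by move=> i; exact: measurableI.
apply/seteqP; split=> x /=; first by move=> [Ax Bx] i; split.
by move=> ABx; split=> i; case: (ABx i).
Qed.

Lemma boxes_setT : boxes setT.
Proof. by exists (fun=> setT) => //; apply/seteqP; split. Qed.

Lemma box_measurable (A : I -> set R) : (forall i, measurable (A i)) ->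
  measurable ([set x | forall i, A i (x i)] : set fspace).
Proof. by move=> mA; apply: sub_sigma_algebra; exists A. Qed.

Lemma measurable_coord i : measurable_fun setT (fun x : fspace => x i).
Proof.
move=> _ B mB; rewrite setTI.
have -> : (fun x : fspace => x i) @^-1` B =
    [set x | forall j, (if j == i then B else setT) (x j)].
  apply/seteqP; split=> x /=; last by move/(_ i); rewrite eqxx.
  by move=> Bx j; case: eqP => // ->.
by apply: (@box_measurable (fun j => if j == i then B else setT)) => j; case: ifP.
Qed.

Lemma measurable_to_fspace d (D : measurableType d) (f : D -> fspace) :
  (forall i, measurable_fun setT (fun w => f w i)) -> measurable_fun setT f.
Proof.
move=> mf; apply: (@measurability _ _ D fspace setT f boxes) => //.
move=> _ [_ [A mA ->] <-]; rewrite setTI.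
have -> : f @^-1` [set x | forall i, A i (x i)] =
    \bigcap_(i in [set: I]) ((fun w => f w i) @^-1` A i).
  by apply/seteqP; split=> x /= Ax i; [move=> _|]; exact: Ax.
apply: fin_bigcap_measurable; first exact: finite_finset.
by move=> i _; rewrite -[X in measurable X]setTI; exact: mf.
Qed.

(** Dynkin's argument: [boxes] is a pi-system containing [setT], so the constant sequence [setT]
    exhausts the space with finite mass. Laws and independence can then be checked on boxes, the
    shape in which [same_law] and [mutually_independent] are given. *)
Lemma fspace_measure_unique (m1 m2 : {measure set fspace -> \bar R}) :
  (m1 setT < +oo)%E -> (forall A, boxes A -> m1 A = m2 A) ->
  forall A, measurable A -> m1 A = m2 A.
Proof.
move=> m1oo m12 A mA.
apply: (@measure_unique _ R fspace boxes (fun=> setT) _ _ _ _ m1 m2) => //.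
- exact: boxes_setI_closed.
- by move=> _; exact: boxes_setT.
- by apply/seteqP; split=> // x _; exists 0%N.
Qed.

End FiniteProductSpace.

Section Independence.
Local Open Scope ereal_scope.
Context {R : realType} {d d0 d1 d2 : measure_display}.
Context {Omega : measurableType d} {Omega0 : measurableType d0}.
Variables (P : probability Omega R) (P0 : probability Omega0 R).

(** Stands in for conditional expectation. The hypothesis merges independence and equality in law,
    since the second factor is the law of a copy [Y0] on another space; the law of the pair is then
    the product measure, and Tonelli integrates the copy first. *)
Lemma independent_integral (D1 : measurableType d1) (D2 : measurableType d2)
    (X : Omega -> D1) (Y : Omega -> D2) (Y0 : Omega0 -> D2)
    (h : D1 * D2 -> \bar R) :
  measurable_fun setT X -> measurable_fun setT Y -> measurable_fun setT Y0 ->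
  (forall A B, measurable A -> measurable B ->
     P (X @^-1` A `&` Y @^-1` B) = P (X @^-1` A) * P0 (Y0 @^-1` B)) ->
  measurable_fun setT h -> (forall z, 0 <= h z) ->
  \int[P]_w h (X w, Y w) = \int[P]_w \int[P0]_v h (X w, Y0 v).
Proof.
move=> mX mY mY0 XY mh h0.
pose rX : {RV P >-> D1} := HB.pack X (isMeasurableFun.Build _ _ _ _ X mX).
pose rY0 : {RV P0 >-> D2} := HB.pack Y0 (isMeasurableFun.Build _ _ _ _ Y0 mY0).
have mXY : measurable_fun setT (fun w => (X w, Y w)).
  exact: measurable_fun_pair.
pose rXY : {RV P >-> (D1 * D2)%type} :=
  HB.pack (fun w => (X w, Y w)) (isMeasurableFun.Build _ _ _ _ _ mXY).
have -> : \int[P]_w h (X w, Y w) = \int[distribution P rXY]_z h z.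
  by rewrite ge0_integral_distribution.
rewrite (eq_measure_integral (distribution P rX \x distribution P0 rY0)).
  rewrite fubini_tonelli1//= /fubini_F ge0_integral_distribution//=.
  - apply: eq_integral => w _ /=; rewrite ge0_integral_distribution//=.
    exact/measurableT_comp/measurable_pair1.
  - exact: measurable_fun_fubini_tonelli_F.
  - by move=> x; exact: integral_ge0.
move=> A mA _; rewrite -(@product_measure_unique _ _ _ _ _ (distribution P rX)
  (distribution P0 rY0) (distribution P rXY)) //.
Qed.

End Independence.

Section IndependentBoxes.
Local Open Scope ereal_scope.
Context {R : realType} {d d0 : measure_display}.
Context {Omega : measurableType d} {Omega0 : measurableType d0}.
Variables (P : probability Omega R) (P0 : probability Omega0 R).
Variables (I J : finType).
Variables (X : Omega -> fspace R I) (Y : Omega -> fspace R J).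
Variable Y0 : Omega0 -> fspace R J.
Hypotheses (mX : measurable_fun setT X) (mY : measurable_fun setT Y).
Hypothesis mY0 : measurable_fun setT Y0.

(** The uniqueness of finite measures is applied to one factor at a time: first in [A] for a fixed
    box [B], then in [B] for a fixed measurable [A]. *)
Lemma independent_boxes :
  (forall A B, boxes A -> boxes B ->
     P (X @^-1` A `&` Y @^-1` B) = P (X @^-1` A) * P0 (Y0 @^-1` B)) ->
  forall A B, measurable A -> measurable B ->
     P (X @^-1` A `&` Y @^-1` B) = P (X @^-1` A) * P0 (Y0 @^-1` B).
Proof.
move=> XY.
pose rX : {RV P >-> fspace R I} := HB.pack X (isMeasurableFun.Build _ _ _ _ X mX).
pose rY0 : {RV P0 >-> fspace R J} :=
  HB.pack Y0 (isMeasurableFun.Build _ _ _ _ Y0 mY0).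
have mXA A : measurable A -> measurable (X @^-1` A).
  by move=> mA; rewrite -[X in measurable X]setTI; exact: mX.
have mYB B : measurable B -> measurable (Y @^-1` B).
  by move=> mB; rewrite -[X in measurable X]setTI; exact: mY.
have mY0B B : measurable B -> measurable (Y0 @^-1` B).
  by move=> mB; rewrite -[X in measurable X]setTI; exact: mY0.
have XY1 A B : measurable A -> boxes B ->
    P (X @^-1` A `&` Y @^-1` B) = P (X @^-1` A) * P0 (Y0 @^-1` B).
  move=> mA bB; have mB : measurable (B : set (fspace R J)).
    exact: sub_sigma_algebra.
  pose m1 := pushforward (mrestr P (mYB _ mB)) X.
  pose c : {nonneg R} := NngNum (fine_ge0 (measure_ge0 P0 (Y0 @^-1` B))).
  have cE : c%:num%:E = P0 (Y0 @^-1` B).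
    by rewrite /= fineK// fin_num_measure//; exact: mY0B.
  pose m2 := mscale c (distribution P rX).
  have -> : P (X @^-1` A) * P0 (Y0 @^-1` B) = m2 A by rewrite -cE muleC.
  have m1T : m1 setT < +oo.
    have -> : m1 setT = P (Y @^-1` B) by congr (P _); exact: setTI.
    by rewrite (le_lt_trans (probability_le1 P (mYB _ mB)))// ltry.
  have m12 C : boxes C -> m1 C = m2 C.
    move=> bC; have -> : m1 C = P (X @^-1` C `&` Y @^-1` B) by [].
    by rewrite XY// -cE muleC.
  exact: (@fspace_measure_unique _ _ m1 m2).
move=> A B mA mB.
have mXA' := mXA _ mA.
pose m1 := pushforward (mrestr P mXA') Y.
pose c : {nonneg R} := NngNum (fine_ge0 (measure_ge0 P (X @^-1` A))).
have cE : c%:num%:E = P (X @^-1` A).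
  by rewrite /= fineK// fin_num_measure.
pose m2 := mscale c (distribution P0 rY0).
have -> : P (X @^-1` A `&` Y @^-1` B) = m1 B by rewrite setIC.
have m1T : m1 setT < +oo.
  have -> : m1 setT = P (X @^-1` A) by congr (P _); exact: setTI.
  by rewrite (le_lt_trans (probability_le1 P mXA'))// ltry.
have m12 C : boxes C -> m1 C = m2 C.
  move=> bC; have -> : m1 C = P (X @^-1` A `&` Y @^-1` C).
    by congr (P _); exact: setIC.
  by rewrite XY1// -cE.
rewrite -cE; exact: (@fspace_measure_unique _ _ m1 m2).
Qed.
End IndependentBoxes.

(** * Sample-path analysis of the algorithm *)

Lemma sum_ord_recr_cond (R : realType) (F : nat -> R) (n w : nat) :
  \sum_(k < n.+1 | (w <= k)%N) F k =
  \sum_(k < n | (w <= k)%N) F k + (if (w <= n)%N then F n else 0).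
Proof. by rewrite big_mkcond big_ord_recr -big_mkcond. Qed.

Section SamplePath.
Variables (R : realType) (m T : nat) (rbar abar bbar blow C : R).
Variables (r : nat -> R) (a b : nat -> 'I_m -> R).

Local Notation eta := (alg_eta T C).
Local Notation W := (alg_W m rbar abar bbar blow).
Local Notation kappa := (alg_kappa m rbar abar bbar blow T C).
Local Notation state := (alg_state rbar abar bbar blow T C r a b).
Local Notation price n := (state n).1.
Local Notation ledger n := (state n).2.
Local Notation x := (alg_x rbar abar bbar blow T C r a b).

Definition warmup : nat :=
  `|Num.ceil (4 * W * Num.sqrt (C * T%:R * ln T%:R) / blow)|%N.

(* [state n] is the state at the start of period n.+1, so [wants n], [grad n] and
   [stockout n] refer to period n.+1. *)
Definition wants (n : nat) : bool := inner a (price n) n.+1 < r n.+1.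

Definition grad (n : nat) (j : 'I_m) : R :=
  b n.+1 j - a n.+1 j * (wants n)%:R.

Definition dual_loss (t : nat) (p : 'I_m -> R) : R :=
  Num.max (r t - inner a p t) 0 + \sum_(j < m) p j * b t j.

Definition norm2 (p : 'I_m -> R) : R := Num.sqrt (\sum_(j < m) p j ^+ 2).

Definition stockout (n : nat) : bool := [&& (warmup <= n)%N, wants n & ~~ x n.+1].

Hypotheses (W0 : 0 <= W) (blow0 : 0 < blow).

Lemma kappaE : kappa = warmup%:R.
Proof.
rewrite /alg_kappa /warmup natr_absz ger0_norm//.
rewrite -(ceil0 R) le_ceil// divr_ge0 ?mulr_ge0 ?sqrtr_ge0//.
exact: ltW.
Qed.

Lemma alg_xE n : x n.+1 =
  [&& (warmup <= n)%N, [forall j, a n.+1 j <= ledger n j] & wants n].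
Proof.
rewrite /alg_x /alg_dec kappaE ler_nat /wants /=.
by case: ltnP.
Qed.

Lemma x_wants n : x n.+1 -> wants n.
Proof. by rewrite alg_xE => /and3P[]. Qed.

Lemma ledgerS n j :
  ledger n.+1 j = ledger n j + b n.+1 j - a n.+1 j * (x n.+1)%:R.
Proof. by []. Qed.

Lemma priceS n j : (warmup <= n)%N ->
  price n.+1 j = Num.max (price n j - eta * grad n j) 0.
Proof.
move=> wn; rewrite /= /grad /wants /= kappaE ler_nat ltnNge.
by case: leqP wn => //= *; congr Num.max.
Qed.

(** The case [n = warmup] is included: the last warm-up period still resets the price, so the first
    active period starts from price zero. *)
Lemma price_warmup n j : (n <= warmup)%N -> price n j = 0.
Proof. by case: n => [//|n] nw; rewrite /= kappaE ler_nat nw. Qed.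

Lemma price_ge0 n j : 0 <= price n j.
Proof.
have [nw|wn] := leqP n warmup; first by rewrite price_warmup.
by case: n wn => // n wn; rewrite priceS// le_max lexx orbT.
Qed.

Lemma ledgerE n j : ledger n j =
  \sum_(k < n) b k.+1 j - \sum_(k < n) a k.+1 j * (x k.+1)%:R.
Proof.
elim: n => [|n IH]; first by rewrite !big_ord0 subr0.
by rewrite ledgerS IH !big_ord_recr /=; ring.
Qed.

Lemma ledger_ge0 n j : (forall t j, 0 <= b t j) -> 0 <= ledger n j.
Proof.
move=> b0; elim: n => [//|n IH]; rewrite ledgerS.
case: (boolP (x n.+1)) => [|_]; last by rewrite mulr0 subr0 addr_ge0.
rewrite alg_xE => /and3P[_ /forallP/(_ j) al _].
by have := b0 n.+1 j; rewrite mulr1; lra.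
Qed.

(** By [ledgerE] the ledger is the slack of the prefix constraint. It stays nonnegative because an
    order is accepted only if the stock before the current replenishment already covers it. *)
Lemma algorithm_feasible : (forall t j, 0 <= b t j) ->
  alg_feasible rbar abar bbar blow T C r a b.
Proof.
move=> b0 j t.
have sumE (F : nat -> R) : \sum_(k < T | (k <= t)%N) F k = \sum_(k < t.+1) F k.
  by rewrite (big_ord_widen T).
rewrite (sumE (fun k => a k.+1 j * (x k.+1)%:R)) (sumE (fun k => b k.+1 j)).
by have := ledger_ge0 t.+1 j b0; rewrite ledgerE subr_ge0.
Qed.

Lemma ledger_warmup n j : (n <= warmup)%N ->
  ledger n j = \sum_(k < n) b k.+1 j.
Proof.
move=> nw; rewrite ledgerE [X in _ - X]big1 ?subr0// => k _.
by rewrite alg_xE leqNgt (leq_trans (ltn_ord k) nw)/= mulr0.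
Qed.

(** * Euclidean norm of the price and size of one dual step *)

Lemma norm2_ge0 p : 0 <= norm2 p. Proof. exact: sqrtr_ge0. Qed.

Lemma norm2_sq p : norm2 p ^+ 2 = \sum_(j < m) p j ^+ 2.
Proof. by rewrite sqr_sqrtr// sumr_ge0// => j _; exact: sqr_ge0. Qed.

Lemma coord_le_norm2 p j : p j <= norm2 p.
Proof.
have [pj|pj] := leP (p j) 0; first exact: le_trans (norm2_ge0 p).
rewrite -[leLHS]ger0_norm ?(ltW pj)// -sqrtr_sqr ler_sqrt.
  by rewrite (bigD1 j)//= lerDl sumr_ge0// => i _; exact: sqr_ge0.
by rewrite sumr_ge0// => i _; exact: sqr_ge0.
Qed.

Lemma norm2_le_sum p : (forall j, 0 <= p j) -> norm2 p <= \sum_(j < m) p j.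
Proof.
move=> p0; have s0 : 0 <= \sum_(j < m) p j by exact: sumr_ge0.
rewrite -[leRHS]ger0_norm// -sqrtr_sqr ler_sqrt ?sqr_ge0//.
rewrite [leRHS]expr2 mulr_suml ler_sum// => j _.
by rewrite expr2 ler_wpM2l// (bigD1 j)//= lerDl sumr_ge0.
Qed.

Hypotheses (rbar0 : 0 <= rbar) (abar0 : 0 <= abar) (bbar0 : 0 <= bbar).
Hypothesis r_bd : forall t, `|r t| <= rbar.
Hypothesis a_bd : forall t j, `|a t j| <= abar.
Hypothesis b_bd : forall t j, 0 <= b t j <= bbar.

Local Notation G := (m%:R * (abar + bbar)).

Lemma eta_ge0 : 0 <= eta. Proof. by rewrite invr_ge0 sqrtr_ge0. Qed.

Lemma grad_bd n j : `|grad n j| <= abar + bbar.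
Proof.
rewrite /grad addrC (le_trans (ler_normD _ _))// normrN.
have /andP[bj0 bj] := b_bd n.+1 j.
rewrite lerD//; last by rewrite ger0_norm.
rewrite normrM; case: wants; rewrite ?normr0 ?mulr0// normr1 mulr1.
exact: a_bd.
Qed.

(** The factor [m] is relaxed to [m ^ 2] so that the same [G] also serves in [grad_dot]. *)
Lemma grad_sq n : \sum_(j < m) grad n j ^+ 2 <= G ^+ 2.
Proof.
apply: (@le_trans _ _ (\sum_(j < m) (abar + bbar) ^+ 2)).
  apply: ler_sum => j _; have /ler_normlP[g1 g2] := grad_bd n j.
  by rewrite -subr_ge0 subr_sqr mulr_ge0// ?subr_ge0//; lra.
rewrite sumr_const card_ord -[leLHS]mulr_natl exprMn.
apply: ler_wpM2r; first exact: sqr_ge0.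
by rewrite expr2 -natrM ler_nat; case: m => // k; rewrite leq_pmull.
Qed.

Lemma grad_dot n : `|\sum_(j < m) price n j * grad n j| <= norm2 (price n) * G.
Proof.
rewrite (le_trans (ler_norm_sum _ _ _))//.
apply: (@le_trans _ _ (\sum_(j < m) norm2 (price n) * (abar + bbar))).
  apply: ler_sum => j _; rewrite normrM ger0_norm ?price_ge0//.
  by apply: ler_pM; rewrite ?price_ge0 ?normr_ge0 ?coord_le_norm2 ?grad_bd.
by rewrite sumr_const card_ord -[leLHS]mulr_natl mulrCA.
Qed.

(** Projection onto the nonnegative orthant does not increase squares coordinatewise; the rest is
    the expansion of the square. *)
Lemma price_step n : (warmup <= n)%N ->
  norm2 (price n.+1) ^+ 2 <= norm2 (price n) ^+ 2
    - 2 * eta * (\sum_(j < m) price n j * grad n j) + (eta * G) ^+ 2.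
Proof.
move=> wn.
apply: (@le_trans _ _ (\sum_(j < m) (price n j - eta * grad n j) ^+ 2)).
  rewrite norm2_sq; apply: ler_sum => j _; rewrite priceS//.
  by rewrite maxEle; case: ifP => _ //; rewrite expr0n/= sqr_ge0.
have -> : \sum_(j < m) (price n j - eta * grad n j) ^+ 2 = norm2 (price n) ^+ 2
    - 2 * eta * (\sum_(j < m) price n j * grad n j)
    + eta ^+ 2 * \sum_(j < m) grad n j ^+ 2.
  rewrite norm2_sq !mulr_sumr -sumrN -!big_split/=.
  by apply: eq_bigr => j _; ring.
by rewrite lerD2l exprMn ler_wpM2l ?sqr_ge0// grad_sq.
Qed.

Lemma price_step_norm n : (warmup <= n)%N ->
  norm2 (price n.+1) <= norm2 (price n) + eta * G.
Proof.
move=> wn; have N0 := norm2_ge0 (price n).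
have eG : 0 <= eta * G by rewrite mulr_ge0 ?eta_ge0// mulr_ge0// addr_ge0.
rewrite -(@ler_pXn2r _ 2)// ?nnegrE ?norm2_ge0 ?addr_ge0//.
rewrite (le_trans (price_step wn))// sqrrD lerD2r lerD2l.
have /ler_normlP[g _] := grad_dot n; have := ler_wpM2l eta_ge0 g.
by rewrite mulrN; lra.
Qed.

(** [wants] selects the active branch of the positive part, so [(r - <p, a>)^+] equals
    [(r - <p, a>)] times the indicator, and the price terms recombine into the pairing with
    [grad]. *)
Lemma wants_dual_loss n : r n.+1 * (wants n)%:R =
  dual_loss n.+1 (price n) - \sum_(j < m) price n j * grad n j.
Proof.
rewrite /dual_loss -addrA -sumrB.
have -> : \sum_(j < m) (price n j * b n.+1 j - price n j * grad n j) =
    inner a (price n) n.+1 * (wants n)%:R.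
  by rewrite /inner mulr_suml; apply: eq_bigr => j _; rewrite /grad; ring.
rewrite /wants; have [lt|ge] := ltP (inner a (price n) n.+1) (r n.+1).
  by rewrite max_l ?subr_ge0 ?(ltW lt)//= !mulr1 subrK.
by rewrite max_r ?subr_le0//= !mulr0 addr0.
Qed.

(** The squared norm is kept on the left so that the induction telescopes. During warm-up the price
    stays zero and only the right side grows. *)
Lemma price_dot_telescope n :
  2 * eta * (\sum_(k < n | (warmup <= k)%N) \sum_(j < m) price k j * grad k j)
    + norm2 (price n) ^+ 2 <= n%:R * (eta * G) ^+ 2.
Proof.
elim: n => [|n IH].
  rewrite big_ord0 mulr0 add0r mul0r norm2_sq big1// => j _.
  by rewrite expr0n.
rewrite (sum_ord_recr_cond (fun k => \sum_(j < m) price k j * grad k j)).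
rewrite -[X in _ <= X * _]natr1.
case: leqP => [wn|nw].
  by have := price_step wn; lra.
rewrite addr0.
have -> : norm2 (price n.+1) ^+ 2 = norm2 (price n) ^+ 2.
  rewrite !norm2_sq; apply: eq_bigr => j _.
  by rewrite !price_warmup ?(ltnW nw).
by have := sqr_ge0 (eta * G); lra.
Qed.

(** * Pathwise duality bound on the regret *)

Lemma hindsight_le_dual q : (forall j, 0 <= q j) ->
  hindsight_opt T r a b <= \sum_(k < T) dual_loss k.+1 q.
Proof.
move=> q0.
have loss0 k : 0 <= dual_loss k q.
  rewrite addr_ge0 ?le_max ?lexx ?orbT// sumr_ge0// => j _.
  by rewrite mulr_ge0//; case/andP: (b_bd k j).
rewrite /hindsight_opt.
(* The maximum starts from 0, which is covered because dual losses are nonnegative for [q >= 0]. *)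
apply: (big_ind (fun y => y <= _)) => [|y z|y /asboolP fy]; first exact: sumr_ge0.
  by rewrite ge_max => -> ->.
have qay : \sum_(k < T) inner a q k.+1 * (y k)%:R
    <= \sum_(k < T) \sum_(j < m) q j * b k.+1 j.
  rewrite exchange_big /=.
  under eq_bigr do rewrite /inner mulr_suml.
  rewrite exchange_big /=; apply: ler_sum => j _.
  under eq_bigr do rewrite -mulrA.
  rewrite -!mulr_sumr ler_wpM2l//.
  (* An empty horizon has no last prefix constraint to invoke. *)
  case: T y fy => [|T'] y fy; first by rewrite !big_ord0.
  have allT (F : 'I_T'.+1 -> R) :
      \sum_(k < T'.+1 | (k <= @ord_max T')%N) F k = \sum_(k < T'.+1) F k.
    by apply: eq_bigl => k; exact: leq_ord.
  by have := fy j ord_max; rewrite !allT.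
rewrite /reward /dual_loss big_split /=.
have : \sum_(k < T) r k.+1 * (y k)%:R
    - \sum_(k < T) inner a q k.+1 * (y k)%:R
    <= \sum_(k < T) Num.max (r k.+1 - inner a q k.+1) 0.
  rewrite -sumrB; apply: ler_sum => k _; rewrite -mulrBl.
  by case: (y k); rewrite ?mulr1 ?mulr0 le_max ?lexx ?orbT.
by lra.
Qed.

(** Scaling by [2 * eta] keeps division out of the path argument. The losses at the running prices
    stay on the left: they are bounded from below only in expectation. *)
Lemma regret_le q : (forall j, 0 <= q j) ->
  2 * eta * (hindsight_opt T r a b - alg_reward rbar abar bbar blow T C r a b
    + \sum_(k < T | (warmup <= k)%N) dual_loss k.+1 (price k))
  <= 2 * eta * (\sum_(k < T) dual_loss k.+1 q
       + rbar * \sum_(k < T) (stockout k)%:R) + T%:R * (eta * G) ^+ 2.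
Proof.
move=> q0.
have dot := price_dot_telescope T.
have hind := hindsight_le_dual q0.
(* After warm-up, [wants] and the actual decision differ only in stockout periods, each of which
   costs at most [rbar]. *)
have alg : \sum_(k < T | (warmup <= k)%N) r k.+1 * (wants k)%:R
    <= alg_reward rbar abar bbar blow T C r a b
       + rbar * \sum_(k < T) (stockout k)%:R.
  rewrite /alg_reward mulr_sumr -big_split /= big_mkcond /=.
  apply: ler_sum => k _; rewrite /stockout.
  have /ler_normlP[rk1 rk2] := r_bd k.+1.
  case: leqP => /= [wk|kw]; last by rewrite alg_xE leqNgt kw/= !mulr0 addr0.
  have xw := @x_wants k.
  case: (x k.+1) xw => [->//|_] /=; first by rewrite mulr0 addr0.
  by case: wants => /=; rewrite ?mulr0 ?mulr1; lra.
have dualE : \sum_(k < T | (warmup <= k)%N) r k.+1 * (wants k)%:R =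
    \sum_(k < T | (warmup <= k)%N) dual_loss k.+1 (price k)
    - \sum_(k < T | (warmup <= k)%N) \sum_(j < m) price k j * grad k j.
  by rewrite -sumrB; apply: eq_bigr => k _; exact: wants_dual_loss.
have N0 := sqr_ge0 (norm2 (price T)).
have : 2 * eta * (hindsight_opt T r a b - alg_reward rbar abar bbar blow T C r a b
    + \sum_(k < T | (warmup <= k)%N) dual_loss k.+1 (price k)) <= 
   2 * eta * (\sum_(k < T) dual_loss k.+1 q + rbar * \sum_(k < T) (stockout k)%:R +
    \sum_(k < T | (warmup <= k)%N) \sum_(j < m) price k j * grad k j).
  by rewrite ler_wpM2l ?mulr_ge0 ?eta_ge0//; lra.
by rewrite [X in _ <= X -> _]mulrDr; lra.
Qed.

(** * Negative drift of the price norm *)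

Lemma price_dot_ge n : \sum_(j < m) price n j * b n.+1 j - rbar <=
  \sum_(j < m) price n j * grad n j.
Proof.
have /ler_normlP[r1 r2] := r_bd n.+1.
have -> : \sum_(j < m) price n j * grad n j = \sum_(j < m) price n j * b n.+1 j
    - inner a (price n) n.+1 * (wants n)%:R.
  by rewrite /inner mulr_suml -sumrB; apply: eq_bigr => j _; rewrite /grad; ring.
(* A wanted order satisfies [<p, a> < r <= rbar]. This caps the upward push of consumption on the
   price whatever the size of [p], while the pull [<p, b>] grows with [p]. *)
rewrite lerD2l lerN2 /wants; case: ltP => /= [lt|_]; rewrite ?mulr1 ?mulr0//.
by rewrite (le_trans (ltW lt)).
Qed.

(** The solution [theta] of [blow / 2 * theta = rbar + blow / 2]. Half of the mean replenishment
    thus pays for the [rbar] of [price_dot_ge] and for the second order term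
    [eta * G ^ 2 / 2 <= blow / 2]; the other half remains as drift. Being at least 1, it also keeps
    the norm away from zero. *)
Definition drift_threshold : R := 2 * rbar / blow + 1.

(* Below the threshold any vector with entries in [0, 1] and sum at least 1 would do:
   this is all that [mgf_le1] needs. *)
Definition direction (p : 'I_m -> R) (j : 'I_m) : R :=
  if drift_threshold <= norm2 p then p j / norm2 p else 1.

Lemma drift_threshold_ge1 : 1 <= drift_threshold.
Proof. by rewrite lerDr divr_ge0 ?mulr_ge0// ltW. Qed.

Lemma direction_itv p j : (forall j, 0 <= p j) -> 0 <= direction p j <= 1.
Proof.
move=> p0; rewrite /direction; case: ifPn => [le|_]; last by rewrite ler01 lexx.
have N0 : 0 < norm2 p.
  exact: lt_le_trans (lt_le_trans ltr01 drift_threshold_ge1) le.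
by rewrite divr_ge0 ?norm2_ge0//= ler_pdivrMr// mul1r coord_le_norm2.
Qed.

(** The l1 norm dominates the l2 norm. Hence means [>= blow] in every coordinate of [b] give mean
    [>= blow] to its combination along [direction]. *)
Lemma direction_sum_ge1 p : (0 < m)%N -> (forall j, 0 <= p j) ->
  1 <= \sum_(j < m) direction p j.
Proof.
move=> m0 p0; have [le|/negbTE nle] := boolP (drift_threshold <= norm2 p).
  under eq_bigr do rewrite /direction le.
  have N0 : 0 < norm2 p.
    exact: lt_le_trans (lt_le_trans ltr01 drift_threshold_ge1) le.
  by rewrite -mulr_suml ler_pdivlMr// mul1r norm2_le_sum.
under eq_bigr do rewrite /direction nle.
by rewrite sumr_const card_ord ler1n.
Qed.

(* With N, N' the old and new norms, N' N <= (N^2 + N'^2) / 2 turns the bound on N'^2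
   of [price_step] into a bound on N' without square roots. *)
Lemma price_drift n : (warmup <= n)%N -> 0 < eta -> eta * G ^+ 2 <= blow ->
  drift_threshold <= norm2 (price n) ->
  norm2 (price n.+1) <= norm2 (price n)
    + eta * (blow / 2 - \sum_(j < m) direction (price n) j * b n.+1 j).
Proof.
move=> wn e0 eG le.
have N0 : 0 < norm2 (price n).
  exact: lt_le_trans (lt_le_trans ltr01 drift_threshold_ge1) le.
have -> : \sum_(j < m) direction (price n) j * b n.+1 j =
    (\sum_(j < m) price n j * b n.+1 j) / norm2 (price n).
  by rewrite mulr_suml; apply: eq_bigr => j _; rewrite /direction le mulrAC.
set S := \sum_(j < m) _.
have step := price_step wn.
have dot := ler_wpM2l (ltW e0) (price_dot_ge n).
have eG2 := ler_wpM2l (ltW e0) eG.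
have thr : eta * (rbar + blow / 2) <= eta * (blow / 2 * norm2 (price n)).
  have b2 : 0 <= blow / 2 by rewrite divr_ge0// ltW.
  rewrite ler_wpM2l ?(ltW e0)//; apply: le_trans (ler_wpM2l b2 le).
  have -> : blow / 2 * drift_threshold = rbar + blow / 2; last exact: lexx.
  by rewrite /drift_threshold; field; rewrite gt_eqF.
rewrite -(ler_pM2r N0) mulrDl -mulrA mulrBl divfK ?gt_eqF//.
have := sqr_ge0 (norm2 (price n.+1) - norm2 (price n)).
move: step dot; rewrite -/S.
set D := \sum_(j < m) _; set N := norm2 _ in thr *; set N' := norm2 _.
rewrite sqrrB exprMn => step dot sq.
lra.
Qed.

(** Above the threshold the first term suffices by [price_drift]; below it, one step adds at most
    [eta * G] and the second term suffices. Adding the two avoids splitting the later integral by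
    cases. *)
Lemma price_exp_drift n (lambda : R) : (warmup <= n)%N -> 0 < eta ->
  eta * G ^+ 2 <= blow -> 0 <= lambda ->
  expR (lambda * norm2 (price n.+1)) <=
  expR (lambda * norm2 (price n)) * expR (lambda * eta *
    (blow / 2 - \sum_(j < m) direction (price n) j * b n.+1 j))
  + expR (lambda * (drift_threshold + eta * G)).
Proof.
move=> wn e0 eG l0; have [le|lt] := leP drift_threshold (norm2 (price n)).
  apply: ler_wpDr; first exact: expR_ge0.
  rewrite -expRD ler_expR -mulrA -mulrDr ler_wpM2l//.
  exact: price_drift.
apply: ler_wpDl; first by rewrite mulr_ge0 ?expR_ge0.
rewrite ler_expR ler_wpM2l// (le_trans (price_step_norm wn))//.
by rewrite lerD2r ltW.
Qed.

(** * Pathwise control of stockouts *)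

Lemma no_stockout n : 0 < eta -> eta * abar <= W / 2 ->
  (forall k j, (warmup <= k < T)%N -> price k j <= W) ->
  (forall j, 3 / 2 * W <= eta * ledger warmup j) ->
  (n < T)%N -> ~~ stockout n.
Proof.
move=> e0 ea pW lW.
(* Both claims need a joint induction. Without a stockout the ledger moves by exactly [grad] and the
   price falls by at most [eta * grad], so [eta * ledger + price] does not decrease; conversely this
   bound excludes the next stockout. *)
suff inv i : (warmup + i <= T)%N ->
    (forall j, eta * ledger warmup j <=
       eta * ledger (warmup + i) j + price (warmup + i) j) /\
    ((warmup + i < T)%N -> ~~ stockout (warmup + i)).
  move=> nT; rewrite /stockout; case: leqP => //= wn.
  have := inv (n - warmup)%N; rewrite subnKC// => -[|_ /(_ nT)]; first exact: ltnW.
  by rewrite /stockout wn.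
(* From [3 / 2 * W] at most [W] is lost to the price, and the remaining [W / 2 >= eta * abar] covers
   any single order. *)
have room k : (warmup <= k < T)%N -> (forall j, eta * ledger warmup j <=
    eta * ledger k j + price k j) -> x k.+1 = wants k.
  move=> /[dup] /andP[wk _] kT inv; rewrite alg_xE wk /=.
  rewrite (_ : [forall j, _])//; apply/forallP => j.
  have := inv j; have := lW j; have := pW k j kT.
  have /ler_normlP[_ aj] := a_bd k.+1 j => p1 l1 i1.
  by rewrite (le_trans aj)// -(ler_pM2l e0); lra.
elim: i => [|i IH] iT.
  rewrite addn0 in iT *; split=> [j|wT]; first by rewrite lerDl price_ge0.
  rewrite /stockout room ?leqnn//; first by case: wants; rewrite ?andbF.
  by move=> j; rewrite lerDl price_ge0.
rewrite addnS in iT *.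
have [inv _] := IH (ltnW iT).
have wi : (warmup <= warmup + i)%N by exact: leq_addr.
have inv' j : eta * ledger warmup j <=
    eta * ledger (warmup + i).+1 j + price (warmup + i).+1 j.
  rewrite (le_trans (inv j))// ledgerS priceS// room// ?wi//.
  have : price (warmup + i) j - eta * grad (warmup + i) j <=
    Num.max (price (warmup + i) j - eta * grad (warmup + i) j) 0.
    by rewrite le_max lexx.
  by rewrite /grad; lra.
split=> // iT'; rewrite /stockout room//; last by rewrite (leqW wi).
by case: wants; rewrite ?andbF.
Qed.

(** A pathwise Chernoff bound: if a price exceeds [W] or some warm-up stock is short, one of the
    exponentials is at least 1 and the trivial count [T] applies; otherwise [no_stockout] gives
    0. *)
Lemma stockouts_le (lambda : R) : 0 < eta -> eta * abar <= W / 2 -> 0 <= lambda ->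
  \sum_(k < T) (stockout k)%:R <=
  T%:R * (\sum_(k < T | (warmup <= k)%N) expR (lambda * (norm2 (price k) - W))
    + \sum_(j < m) expR (lambda * (3 / 2 * W - eta * ledger warmup j))).
Proof.
move=> e0 ea l0.
have exp_ge1 (y z : R) : y < z -> 1 <= expR (lambda * (z - y)).
  by move=> yz; rewrite -expR0 ler_expR mulr_ge0// subr_ge0 ltW.
have sum0 (I : finType) (Q : pred I) (F : I -> R) :
    0 <= \sum_(i | Q i) expR (F i) by rewrite sumr_ge0// => i _; exact: expR_ge0.
have triv y : 1 <= y -> \sum_(k < T) (stockout k)%:R <= T%:R * y.
  move=> y1; apply: (@le_trans _ _ (\sum_(k < T) 1)).
    by apply: ler_sum => k _; case: stockout.
  by rewrite sumr_const card_ord -[leLHS]mulr_natl ler_wpM2l ?ler0n// mulr1.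
have [/existsP[k /existsP[j /andP[wk pk]]]|/existsPn noP] :=
  boolP [exists k : 'I_T, exists j, (warmup <= k)%N && (W < price k j)].
  apply: triv; apply: ler_wpDr; first exact: sum0.
  rewrite (bigD1 k)//=; apply: ler_wpDr; first exact: sum0.
  by rewrite exp_ge1// (lt_le_trans pk)// coord_le_norm2.
have [/existsP[j lj]|/existsPn noL] :=
  boolP [exists j, eta * ledger warmup j < 3 / 2 * W].
  apply: triv; apply: ler_wpDl; first exact: sum0.
  rewrite (bigD1 j)//=; apply: ler_wpDr; first exact: sum0.
  by rewrite exp_ge1.
rewrite big1 => [|k _]; first by rewrite mulr_ge0 ?addr_ge0.
rewrite (negbTE (no_stockout _ _ _ _ _))//.
  move=> i j /andP[wi iT]; have /existsPn/(_ j) := noP (Ordinal iT).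
  by rewrite negb_and wi/= leNgt.
by move=> j; have := noL j; rewrite -leNgt.
Qed.

End SamplePath.

(** * Measurability *)

Section Measurability.
Context {d : measure_display} {D : measurableType d} {R : realType}.
Variables (m T : nat) (rbar abar bbar blow C : R).
Variables (r : nat -> D -> R) (a b : nat -> 'I_m -> D -> R).
Hypotheses (mr : forall t, measurable_fun setT (r t))
  (ma : forall t j, measurable_fun setT (a t j))
  (mb : forall t j, measurable_fun setT (b t j)).

Local Notation state n w := (alg_state rbar abar bbar blow T C (fun t => r t w)
  (fun t j => a t j w) (fun t j => b t j w) n).

Lemma measurable_forall (I : finType) (f : I -> D -> bool) :
  (forall i, measurable_fun setT (f i)) ->
  measurable_fun setT (fun w => [forall i, f i w]).
Proof.
move=> mf; apply: (measurable_fun_bool true); rewrite setTI.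
have -> : (fun w => [forall i, f i w]) @^-1` [set true] =
    \bigcap_(i in [set: I]) (f i @^-1` [set true]).
  apply/seteqP; split=> w /=; first by move=> /forallP fw i _; exact: fw.
  by move=> fw; apply/forallP => i; exact: fw.
apply: fin_bigcap_measurable; first exact: finite_finset.
by move=> i _; rewrite -[X in measurable X]setTI; exact: mf.
Qed.

Lemma measurable_natb (f : D -> bool) : measurable_fun setT f ->
  measurable_fun setT (fun w => (f w)%:R : R).
Proof.
move=> mf; rewrite (_ : (fun w => _) = (fun w => if f w then 1 else 0)).
  exact: measurable_fun_ifT.
by apply/funext => w; case: (f w).
Qed.

Lemma measurable_sum_cond (I : finType) (Q : pred I) (f : I -> D -> R) :
  (forall i, measurable_fun setT (f i)) ->
  measurable_fun setT (fun w => \sum_(i | Q i) f i w).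
Proof.
by move=> mf; under eq_fun do rewrite -big_filter; exact: measurable_sum.
Qed.

Lemma measurable_inner t (p : 'I_m -> D -> R) :
  (forall j, measurable_fun setT (p j)) ->
  measurable_fun setT (fun w => inner (fun t j => a t j w) (fun j => p j w) t).
Proof.
by move=> mp; apply: measurable_sum => j; exact: measurable_funM.
Qed.

Lemma measurable_state n : (forall j, measurable_fun setT (fun w => (state n w).1 j)) /\
  (forall j, measurable_fun setT (fun w => (state n w).2 j)).
Proof.
elim: n => [|n [mp ml]]; first by split=> j; exact: measurable_cst.
have macc : measurable_fun setT (fun w =>
    inner (fun t j => a t j w) (state n w).1 n.+1 < r n.+1 w).
  by apply: measurable_fun_ltr => //; exact: measurable_inner.
split=> j /=.
  case: (n.+1%:R <= alg_kappa m rbar abar bbar blow T C); first exact: measurable_cst.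
  apply: measurable_maxr => //; apply: measurable_funB => //.
  apply: measurable_funM => //; apply: measurable_funB => //.
  by apply: measurable_funM => //; exact: measurable_natb.
apply: measurable_funB; first exact: measurable_funD.
apply: measurable_funM => //; apply: measurable_natb; rewrite /alg_dec.
case: (n.+1%:R <= alg_kappa m rbar abar bbar blow T C); first exact: measurable_cst.
apply: measurable_and => //; apply: measurable_forall => i.
exact: measurable_fun_ler.
Qed.

Lemma measurable_alg_reward : measurable_fun setT (fun w =>
  alg_reward rbar abar bbar blow T C (fun t => r t w) (fun t j => a t j w)
    (fun t j => b t j w)).
Proof.
apply: measurable_sum => k; apply: measurable_funM => //; apply: measurable_natb.
rewrite /alg_x /alg_dec.
case: (k.+1%:R <= alg_kappa m rbar abar bbar blow T C); first exact: measurable_cst.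
have [mp ml] := measurable_state k.
apply: measurable_and.
  by apply: measurable_forall => i; exact: measurable_fun_ler.
by apply: measurable_fun_ltr => //; exact: measurable_inner.
Qed.

(* [Num.max] has no neutral element on R, so [big_mkcond] does not apply. *)
Lemma bigmax_ge0_mkcond (I : Type) (s : seq I) (Q : pred I) (F : I -> R) :
  \big[Num.max/0]_(i <- s | Q i) F i =
  \big[Num.max/0]_(i <- s) (if Q i then Num.max (F i) 0 else 0).
Proof.
elim: s => [|i s IH]; first by rewrite !big_nil.
have s0 : 0 <= \big[Num.max/0]_(i <- s) (if Q i then Num.max (F i) 0 else 0).
  apply: (big_ind (fun y => 0 <= y)) => [//|y z y0 z0|k _].
    by rewrite le_max y0.
  by case: ifP => // _; rewrite le_max lexx orbT.
rewrite !big_cons IH; case: (Q i); last by rewrite max_r.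
by rewrite -maxA (max_r s0).
Qed.

Lemma measurable_hindsight_opt : measurable_fun setT (fun w =>
  hindsight_opt T (fun t => r t w) (fun t j => a t j w) (fun t j => b t j w)).
Proof.
rewrite /hindsight_opt.
(* Feasibility is restated as a finite boolean conjunction of comparisons, whose measurability
   follows clause by clause. *)
pose Q (y : {ffun 'I_T -> bool}) w := [forall j : 'I_m, forall t : 'I_T,
  \sum_(k < T | (k <= t)%N) a k.+1 j w * (y k)%:R
  <= \sum_(k < T | (k <= t)%N) b k.+1 j w].
have QE (y : {ffun 'I_T -> bool}) w : `[< feasible (fun t j => a t j w) (fun t j => b t j w) y >] = Q y w.
  apply/asboolP/forallP => [fy j|fy j t]; first by apply/forallP => t; exact: fy.
  by have /forallP := fy j; exact.
have mQ y : measurable_fun setT (Q y).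
  apply: measurable_forall => j; apply: measurable_forall => t.
  apply: measurable_fun_ler; apply: measurable_sum_cond => // k.
  by apply: measurable_funM => //; exact: measurable_cst.
have mrew (y : {ffun 'I_T -> bool}) : measurable_fun setT
    (fun w => reward (fun t => r t w) y).
  by apply: measurable_sum => k; apply: measurable_funM => //; exact: measurable_cst.
under eq_fun do rewrite bigmax_ge0_mkcond.
elim: (index_enum _) => [|y s IH].
  by under eq_fun do rewrite big_nil; exact: measurable_cst.
under eq_fun do rewrite big_cons QE.
apply: measurable_maxr => //; apply: measurable_fun_ifT => //.
by apply: measurable_maxr => //; exact: measurable_cst.
Qed.

End Measurability.

(** * Independence of the past and the current draw *)

Notation obs_index m := (option ('I_m + 'I_m)%type).

Definition obs {Omega : Type} {R : realType} {m : nat} (r : Omega -> R)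
    (a b : 'I_m -> Omega -> R) (w : Omega) : fspace R (obs_index m) :=
  fun i => match i with
           | None => r w
           | Some (inl j) => a j w
           | Some (inr j) => b j w
           end.

Lemma measurable_obs {d} {Omega : measurableType d} {R : realType} m
    (r : Omega -> R) (a b : 'I_m -> Omega -> R) :
  measurable_fun setT r -> (forall j, measurable_fun setT (a j)) ->
  (forall j, measurable_fun setT (b j)) -> measurable_fun setT (obs r a b).
Proof.
move=> mr ma mb; apply: measurable_to_fspace => -[[j|j]|].
- exact: ma.
- exact: mb.
- exact: mr.
Qed.

(** The bridge between the generators of the product sigma-algebra and the rectangle events in which
    law and independence are assumed. *)
Lemma obs_preimage_box {Omega : Type} {R : realType} m (r : Omega -> R)
    (a b : 'I_m -> Omega -> R) (A : obs_index m -> set R) :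
  obs r a b @^-1` [set y | forall i, A i (y i)] =
  rect_event r a b (A None) (fun j => A (Some (inl j))) (fun j => A (Some (inr j))).
Proof.
apply/seteqP; split=> w /=.
  move=> Aw; split; first exact: (Aw None).
  by split=> j; [exact: (Aw (Some (inl j)))|exact: (Aw (Some (inr j)))].
by move=> [A0 [Aa Ab]] [[j|j]|].
Qed.

Section History.
Local Open Scope ereal_scope.
Context {d d0 : measure_display} {Omega : measurableType d}
  {Omega0 : measurableType d0} {R : realType}.
Variables (P : probability Omega R) (P0 : probability Omega0 R) (m T : nat).
Variables (r : nat -> Omega -> R) (a b : nat -> 'I_m -> Omega -> R).
Variables (r0 : Omega0 -> R) (a0 b0 : 'I_m -> Omega0 -> R).
Hypotheses (mr : forall t, measurable_fun setT (r t))
  (ma : forall t j, measurable_fun setT (a t j))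
  (mb : forall t j, measurable_fun setT (b t j)).
Hypotheses (mr0 : measurable_fun setT r0)
  (ma0 : forall j, measurable_fun setT (a0 j))
  (mb0 : forall j, measurable_fun setT (b0 j)).
Hypothesis law : forall t, (1 <= t <= T)%N ->
  same_law P P0 (r t) (a t) (b t) r0 a0 b0.
Hypothesis indep : mutually_independent P T r a b.

Definition history (n : nat) (w : Omega) : fspace R ('I_n * obs_index m)%type :=
  fun ki => obs (r ki.1.+1) (a ki.1.+1) (b ki.1.+1) w ki.2.

Arguments history : clear implicits.

Lemma measurable_history n : measurable_fun setT (history n).
Proof.
apply: measurable_to_fspace => -[k i]; rewrite /history /=.
have mo := measurable_obs (mr k.+1) (ma k.+1) (mb k.+1).
exact: measurableT_comp (@measurable_coord _ _ i) mo.
Qed.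

(** Independence is used for the earlier periods [S] and again for [S] together with [N], the
    ordinal of period [n.+1]. The additional factor is then moved to [P0] by [law]. *)
Lemma history_obs_boxes n (nT : (n < T)%N) A B : boxes A -> boxes B ->
  P (history n @^-1` A `&` obs (r n.+1) (a n.+1) (b n.+1) @^-1` B) =
  P (history n @^-1` A) * P0 (obs r0 a0 b0 @^-1` B).
Proof.
move=> [A' mA ->] [B' mB ->].
(* One family of rectangles for all periods: those of [A'] before index [n], and [B'] from [n] on,
   where only index [n] itself is ever evaluated. *)
pose rect (t : 'I_T) i : set R :=
  oapp (fun k : 'I_n => A' (k, i)) (B' i) (insub (t : nat)).
have mrect t i : measurable (rect t i).
  by rewrite /rect; case: insub => [k|] /=; [exact: mA|exact: mB].
pose ev (t : 'I_T) := rect_event (r t.+1) (a t.+1) (b t.+1) (rect t None)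
  (fun j => rect t (Some (inl j))) (fun j => rect t (Some (inr j))).
have evE t : ev t = obs (r t.+1) (a t.+1) (b t.+1) @^-1`
    [set y | forall i, rect t i (y i)] by rewrite obs_preimage_box.
pose N := Ordinal nT; pose S := [set t : 'I_T | (t < n)%N]%SET.
have rectN i : rect N i = B' i by rewrite /rect insubN//= ltnn.
have NS : N \notin S by rewrite inE ltnn.
have histE : history n @^-1` [set x | forall i, A' i (x i)] =
    \bigcap_(t in [set t | t \in S]) ev t.
  apply/seteqP; split=> w /=.
    move=> Aw t; rewrite /= inE => tn; rewrite evE /= => i.
    by rewrite /rect insubT /=; exact: (Aw (Ordinal tn, i)).
  move=> Sw [k i]; have kT := ltn_trans (ltn_ord k) nT.
  have kS : Ordinal kT \in S by rewrite inE /=.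
  have := Sw _ kS; rewrite evE /= => /(_ i); rewrite /rect /= (insubT (fun x => x < n)%N (ltn_ord k)) /=.
  by rewrite (_ : Sub _ _ = k)//; exact: val_inj.
have obsE : obs (r n.+1) (a n.+1) (b n.+1) @^-1` [set x | forall i, B' i (x i)] = ev N.
  rewrite evE; apply/seteqP; split=> w /= Bw i; have := Bw i; by rewrite rectN.
have NSE : \bigcap_(t in [set t | t \in S]) ev t `&` ev N =
    \bigcap_(t in [set t | t \in (N |: S)%SET]) ev t.
  apply/seteqP; split=> w /=.
    by move=> [Sw Nw] t; rewrite /= in_setU1 => /orP[/eqP->//|]; exact: Sw.
  move=> Sw; split; last by apply: Sw; rewrite /= setU11.
  by move=> t tS; apply: Sw; rewrite /= in_setU1 tS orbT.
rewrite histE obsE NSE /ev !indep//.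
rewrite big_setU1//= muleC; congr (_ * _).
rewrite law//.
by rewrite -obs_preimage_box; congr (P0 _); apply/seteqP; split=> w /= Bw i;
  have := Bw i; rewrite rectN.
Qed.

Lemma integral_history_obs n (h : fspace R ('I_n * obs_index m)%type *
    fspace R (obs_index m) -> \bar R) : (n < T)%N ->
  measurable_fun setT h -> (forall z, 0 <= h z) ->
  \int[P]_w h (history n w, obs (r n.+1) (a n.+1) (b n.+1) w) =
  \int[P]_w \int[P0]_v h (history n w, obs r0 a0 b0 v).
Proof.
move=> nT mh h0; apply: independent_integral => //.
- exact: measurable_history.
- exact: measurable_obs.
- exact: measurable_obs.
apply: independent_boxes; [exact: measurable_history|exact: measurable_obs|
  exact: measurable_obs|].
by move=> A B; exact: history_obs_boxes.
Qed.

End History.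
Arguments history {d Omega R m} r a b n w.

(** Non-anticipation: the state after [n] periods reads no draw outside periods 1 to [n]. *)
Lemma alg_state_ext (R : realType) m (rbar abar bbar blow C : R) T
    (r r' : nat -> R) (a a' b b' : nat -> 'I_m -> R) n :
  (forall t, (1 <= t <= n)%N -> [/\ r t = r' t, a t = a' t & b t = b' t]) ->
  alg_state rbar abar bbar blow T C r a b n =
  alg_state rbar abar bbar blow T C r' a' b' n.
Proof.
elim: n => [//|n IH] eqn /=; rewrite IH => [|t /andP[t1 tn]]; last first.
  by apply: eqn; rewrite t1 leqW.
have [rE aE bE] := eqn n.+1 (leqnn _).
by rewrite /alg_step /alg_dec /inner rE aE bE.
Qed.

Section StateIntegral.
Local Open Scope ereal_scope.
Context {d d0 : measure_display} {Omega : measurableType d}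
  {Omega0 : measurableType d0} {R : realType}.
Variables (P : probability Omega R) (P0 : probability Omega0 R) (m T : nat).
Variables (r : nat -> Omega -> R) (a b : nat -> 'I_m -> Omega -> R).
Variables (r0 : Omega0 -> R) (a0 b0 : 'I_m -> Omega0 -> R).
Hypotheses (mr : forall t, measurable_fun setT (r t))
  (ma : forall t j, measurable_fun setT (a t j))
  (mb : forall t j, measurable_fun setT (b t j)).
Hypotheses (mr0 : measurable_fun setT r0)
  (ma0 : forall j, measurable_fun setT (a0 j))
  (mb0 : forall j, measurable_fun setT (b0 j)).
Hypothesis law : forall t, (1 <= t <= T)%N ->
  same_law P P0 (r t) (a t) (b t) r0 a0 b0.
Hypothesis indep : mutually_independent P T r a b.
Variables (rbar abar bbar blow C : R).

Local Notation state n w := (alg_state rbar abar bbar blow T C (fun t => r t w)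
  (fun t j => a t j w) (fun t j => b t j w) n).
Local Notation state_space := (fspace R 'I_m * fspace R 'I_m)%type.

(** Decodes a history vector into sequences. Periods are numbered from 1, hence [t.-1]; the default
    0 beyond period [n] is invisible to the state by [alg_state_ext]. *)
Definition past n (x : fspace R ('I_n * obs_index m)%type) (i : obs_index m)
    (t : nat) : R :=
  if insub t.-1 is Some k then x (k, i) else 0%R.

Lemma measurable_past n i t : measurable_fun setT (fun x => @past n x i t).
Proof.
rewrite /past; case: insub => [k|]; last exact: measurable_cst.
exact: measurable_coord.
Qed.

Definition state_of_past n (x : fspace R ('I_n * obs_index m)%type) : state_space :=
  alg_state rbar abar bbar blow T C (past x None)
    (fun t j => past x (Some (inl j)) t) (fun t j => past x (Some (inr j)) t) n.

Lemma measurable_state_of_past n : measurable_fun setT (@state_of_past n).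
Proof.
have [mp ml] := @measurable_state _ _ R m T rbar abar bbar blow C
  (fun t x => @past n x None t) (fun t j x => past x (Some (inl j)) t)
  (fun t j x => past x (Some (inr j)) t) (fun t => measurable_past None t)
  (fun t j => measurable_past (Some (inl j)) t)
  (fun t j => measurable_past (Some (inr j)) t) n.
by apply/measurable_fun_pairP; split; exact: measurable_to_fspace.
Qed.

Lemma state_of_history n w : state_of_past (history r a b n w) = state n w.
Proof.
apply: alg_state_ext => -[//|t] /andP[_ tn].
have pastE i : past (history r a b n w) i t.+1 = obs (r t.+1) (a t.+1) (b t.+1) w i.
  by rewrite /past /= insubT.
by split; [|apply/funext => j|apply/funext => j]; rewrite pastE.
Qed.

Lemma integral_state_obs n (h : state_space * fspace R (obs_index m) -> R) :
  (n < T)%N -> measurable_fun setT h ->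
  (forall w, (0 <= h (state n w, obs (r n.+1) (a n.+1) (b n.+1) w))%R) ->
  (forall w v, (0 <= h (state n w, obs r0 a0 b0 v))%R) ->
  \int[P]_w (h (state n w, obs (r n.+1) (a n.+1) (b n.+1) w))%:E =
  \int[P]_w \int[P0]_v (h (state n w, obs r0 a0 b0 v))%:E.
Proof.
move=> nT mh hp hp0.
(* [h] is nonnegative only along reachable states, while Tonelli needs this everywhere; cutting at 0
   changes no value that is integrated. *)
pose g (z : fspace R ('I_n * obs_index m)%type * fspace R (obs_index m)) :=
  (Num.max (h (state_of_past z.1, z.2)) 0)%:E.
have mg : measurable_fun setT g.
  apply/measurable_EFinP; apply: measurable_maxr; last exact: measurable_cst.
  apply: measurableT_comp => //; apply: measurable_fun_pair => //.
  by apply: measurableT_comp; first exact: measurable_state_of_past.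
have g0 z : 0 <= g z by rewrite lee_fin le_max lexx orbT.
have := integral_history_obs mr ma mb mr0 ma0 mb0 law indep nT mg g0.
rewrite /g /=.
under eq_integral do rewrite state_of_history max_l//.
move=> ->; apply: eq_integral => w _; apply: eq_integral => v _.
by rewrite state_of_history max_l.
Qed.

Lemma measurable_state_pair n :
  measurable_fun setT (fun w => state n w : state_space).
Proof.
have [mp ml] := @measurable_state _ _ R m T rbar abar bbar blow C r a b mr ma mb n.
by apply/measurable_fun_pairP; split; exact: measurable_to_fspace.
Qed.

Lemma measurable_integral_state_obs n
    (h : state_space * fspace R (obs_index m) -> R) :
  measurable_fun setT h ->
  (forall w v, (0 <= h (state n w, obs r0 a0 b0 v))%R) ->
  measurable_fun setT (fun w => \int[P0]_v (h (state n w, obs r0 a0 b0 v))%:E).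
Proof.
move=> mh hp0.
pose g (z : state_space * Omega0) := (Num.max (h (z.1, obs r0 a0 b0 z.2)) 0)%:E.
have mg : measurable_fun setT g.
  apply/measurable_EFinP; apply: measurable_maxr; last exact: measurable_cst.
  apply: measurableT_comp => //; apply: measurable_fun_pair => //.
  by apply: measurableT_comp; first exact: measurable_obs.
have g0 z : 0 <= g z by rewrite lee_fin le_max lexx orbT.
have mG := measurable_fun_fubini_tonelli_F (m2 := P0) g mg g0.
rewrite (_ : (fun w => _) = fubini_F P0 g \o (fun w => state n w)).
  by apply: measurableT_comp => //; exact: measurable_state_pair.
apply/funext => w /=; rewrite /fubini_F; apply: eq_integral => v _.
by rewrite /g /= max_l.
Qed.

End StateIntegral.

(** * Exponential moment of a single replenishment *)

Section MomentGeneratingFunction.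
Context {d0 : measure_display} {Omega0 : measurableType d0} {R : realType}.
Variables (P0 : probability Omega0 R) (m : nat) (b0 : 'I_m -> Omega0 -> R).
Variables (bbar blow : R).
Hypotheses (bbar0 : 0 <= bbar) (blow0 : 0 < blow).
Hypothesis mb0 : forall j, measurable_fun setT (b0 j).
Hypothesis b0_bd : forall j v, 0 <= b0 j v <= bbar.
Hypothesis b0_mean : forall j, (blow%:E <= \int[P0]_v (b0 j v)%:E)%E.

(* Chosen so that 1 - s blow / 2 + 2 s^2 M^2 = 1 for M = blow + m bbar, an upper bound
   of the exponent in [mgf_le1]. *)
Definition mgf_rate : R := blow / (4 * (blow + m%:R * bbar) ^+ 2).

Lemma mgf_rate_gt0 : 0 < mgf_rate.
Proof.
have M0 : 0 < blow + m%:R * bbar by rewrite ltr_wpDr// mulr_ge0.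
by rewrite divr_gt0// mulr_gt0// exprn_gt0.
Qed.

(** From [exp (- y) >= 1 - y] one gets [exp y * (1 - y) <= 1], while [(1 + y + 2 y^2) (1 - y) = 1 +
    y^2 (1 - 2 y) >= 1]. *)
Lemma expR_le_quadratic (y : R) : `|y| <= 1 / 2 -> expR y <= 1 + y + 2 * y ^+ 2.
Proof.
move=> /ler_normlP[y1 y2].
have e1 := expR_ge1Dx (- y).
have e0 := expR_gt0 y; have eN : expR y * expR (- y) = 1 by rewrite -expRD subrr expR0.
have y3 : 0 < 1 - y by lra.
rewrite -(ler_pM2r y3).
apply: (@le_trans _ _ 1).
  by have := ler_wpM2l (ltW e0) e1; rewrite eN.
rewrite -subr_ge0.
have -> : (1 + y + 2 * y ^+ 2) * (1 - y) - 1 = y ^+ 2 * (1 - 2 * y) by ring.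
by rewrite mulr_ge0 ?sqr_ge0//; lra.
Qed.

(** The bracket in the exponent has mean at most [- blow / 2], and [mgf_rate] is small enough for
    this linear gain to offset the quadratic term. *)
Lemma mgf_le1 (u : 'I_m -> R) : (forall j, 0 <= u j <= 1) -> 1 <= \sum_(j < m) u j ->
  (\int[P0]_v (expR (mgf_rate * (blow / 2 - \sum_(j < m) u j * b0 j v)))%:E <= 1)%E.
Proof.
move=> u01 u1; set s := mgf_rate; pose M := blow + m%:R * bbar.
have s0 := mgf_rate_gt0; rewrite -/s in s0.
have M0 : 0 < M by rewrite ltr_wpDr// mulr_ge0.
have u0 j : 0 <= u j by case/andP: (u01 j).
have b00 j v : 0 <= b0 j v by case/andP: (b0_bd j v).
pose S v := \sum_(j < m) u j * b0 j v.
have S0 v : 0 <= S v by rewrite sumr_ge0// => j _; rewrite mulr_ge0.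
have SM v : S v <= m%:R * bbar.
  rewrite mulr_natl -[X in _ *+ X](card_ord m) -sumr_const; apply: ler_sum => j _.
  have /andP[_ uj] := u01 j; have /andP[bj0 bj] := b0_bd j v.
  by rewrite (le_trans _ bj)// -[leRHS]mul1r ler_wpM2r.
have mS : measurable_fun setT S.
  by apply: measurable_sum => j; apply: measurable_funM => //; exact: measurable_cst.
have sM2 : 4 * s * M ^+ 2 = blow.
  rewrite /s /mgf_rate -/M; field; by rewrite gt_eqF.
have sM : s * M <= 1 / 2.
  have bM : blow <= M by rewrite lerDl mulr_ge0.
  by rewrite -(ler_pM2r M0); lra.
(* The linear term sits on the left so that both integrands are nonnegative; its integral, at least
   [s * blow], is cancelled at the end. *)
have pointwise v : expR (s * (blow / 2 - S v)) + s * S v <= 1 + s * blow.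
  have Z1 : `|blow / 2 - S v| <= M.
    have mb : 0 <= m%:R * bbar by rewrite mulr_ge0.
    move: (S0 v) (SM v) mb blow0 => S0v SMv mb bl.
    by apply/ler_normlP; rewrite /M; split; lra.
  have Z2 : (blow / 2 - S v) ^+ 2 <= M ^+ 2.
    by rewrite -real_normK ?num_real// ler_pXn2r ?nnegrE ?(ltW M0).
  have := @expR_le_quadratic (s * (blow / 2 - S v)).
  rewrite normrM (gtr0_norm s0) => /(_ (le_trans (ler_wpM2l (ltW s0) Z1) sM)).
  have := ler_wpM2l (ltW s0) (ler_wpM2l (ltW s0) Z2).
  have : s * s * M ^+ 2 * 4 = s * blow by rewrite -sM2; ring.
  set Z := blow / 2 - S v; rewrite exprMn => h1 h2 h3.
  have : s * Z = s * blow / 2 - s * S v by rewrite /Z; ring.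
  lra.
have : (\int[P0]_v ((expR (s * (blow / 2 - S v)))%:E + (s * S v)%:E) <=
    (1 + s * blow)%:E)%E.
  rewrite -[leRHS]mule1 -(probability_setT P0) -integral_cst//.
  apply: ge0_le_integral => //.
  - by move=> v _; rewrite -EFinD lee_fin addr_ge0 ?expR_ge0// mulr_ge0// ltW.
  - apply/measurable_EFinP; apply: measurable_funD; last exact: measurable_funM.
    apply: measurableT_comp => //; apply: measurable_funM => //.
    exact: measurable_funB.
  - by move=> v _; rewrite lee_fin.
rewrite ge0_integralD//; first last.
- by apply/measurable_EFinP; exact: measurable_funM.
- by move=> v _; rewrite lee_fin mulr_ge0// ltW.
- apply/measurable_EFinP; apply: measurableT_comp => //; apply: measurable_funM => //.
  exact: measurable_funB.
have SE : ((s * blow)%:E <= \int[P0]_v (s * S v)%:E)%E.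
  under eq_integral do rewrite EFinM.
  rewrite ge0_integralZl_EFin//; last 3 first.
  - by move=> v _; rewrite lee_fin.
  - exact/measurable_EFinP.
  - exact: ltW.
  rewrite EFinM lee_wpmul2l//; first by rewrite lee_fin ltW.
  under eq_integral do rewrite /S -sumEFin.
  rewrite ge0_integral_sum//; last 2 first.
  - by move=> j; apply/measurable_EFinP; exact: measurable_funM.
  - by move=> j v _; rewrite lee_fin mulr_ge0.
  apply: (@le_trans _ _ (\sum_(j < m) (u j * blow)%:E)%E).
    by rewrite sumEFin lee_fin -mulr_suml -[leLHS]mul1r ler_wpM2r// ltW.
  apply: lee_sum => j _; under eq_integral do rewrite EFinM.
  rewrite ge0_integralZl_EFin//; last 2 first.
  - by move=> v _; rewrite lee_fin.
  - exact/measurable_EFinP.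
  by rewrite EFinM lee_wpmul2l ?lee_fin.
move=> H; have := le_trans (leeD2l _ SE) H.
by rewrite EFinD leeD2rE//.
Qed.

End MomentGeneratingFunction.

(** * Exponential moments and dual values *)

Definition obs_loss {R : realType} {m : nat} (p : 'I_m -> R)
    (y : obs_index m -> R) : R :=
  dual_loss (fun=> y None) (fun _ j => y (Some (inl j)))
    (fun _ j => y (Some (inr j))) 0 p.

Lemma obs_loss_ge0 {R : realType} {m : nat} (p : 'I_m -> R) (y : obs_index m -> R) :
  (forall j, 0 <= p j) -> (forall j, 0 <= y (Some (inr j))) -> 0 <= obs_loss p y.
Proof.
move=> p0 y0; rewrite addr_ge0// ?le_max ?lexx ?orbT// sumr_ge0// => j _.
by rewrite mulr_ge0.
Qed.

Lemma measurable_obs_loss {d} {D : measurableType d} {R : realType} {m : nat}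
    (p : D -> 'I_m -> R) (y : D -> obs_index m -> R) :
  (forall j, measurable_fun setT (fun w => p w j)) ->
  (forall i, measurable_fun setT (fun w => y w i)) ->
  measurable_fun setT (fun w => obs_loss (p w) (y w)).
Proof.
move=> mp my; apply: measurable_funD.
  apply: measurable_maxr; last exact: measurable_cst.
  apply: measurable_funB => //; apply: measurable_sum => j; exact: measurable_funM.
by apply: measurable_sum => j; exact: measurable_funM.
Qed.

Definition expected_dual {d0} {Omega0 : measurableType d0} {R : realType} {m : nat}
    (P0 : probability Omega0 R) (r0 : Omega0 -> R) (a0 b0 : 'I_m -> Omega0 -> R)
    (p : 'I_m -> R) : \bar R :=
  (\int[P0]_v (obs_loss p (obs r0 a0 b0 v))%:E)%E.

Lemma measurable_norm2 {d} {D : measurableType d} {R : realType} {m : nat}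
    (p : D -> 'I_m -> R) : (forall j, measurable_fun setT (fun w => p w j)) ->
  measurable_fun setT (fun w => norm2 (p w)).
Proof.
move=> mp; rewrite /norm2 (_ : (fun w => _) =
    (fun w => powR (\sum_(j < m) p w j ^+ 2) 2^-1)).
  have mS : measurable_fun setT (fun w => \sum_(j < m) p w j ^+ 2).
    by apply: measurable_sum => j; exact: measurable_funX.
  exact: measurableT_comp (measurable_powR _) mS.
apply/funext => w; rewrite powR12_sqrt// sumr_ge0// => j _; exact: sqr_ge0.
Qed.

Lemma integral_probability_cst {d} {D : measurableType d} {R : realType}
  (P : probability D R) (c : R) : (\int[P]__ c%:E = c%:E)%E.
Proof.
by rewrite integral_cst// -[RHS]mule1; congr (_ * _)%E; exact: probability_setT.
Qed.

Section Moments.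
Local Open Scope ereal_scope.
Context {d d0 : measure_display} {Omega : measurableType d}
  {Omega0 : measurableType d0} {R : realType}.
Variables (P : probability Omega R) (P0 : probability Omega0 R) (m T : nat).
Variables (r : nat -> Omega -> R) (a b : nat -> 'I_m -> Omega -> R).
Variables (r0 : Omega0 -> R) (a0 b0 : 'I_m -> Omega0 -> R).
Variables (rbar abar bbar blow C : R).
Hypothesis m_gt0 : (0 < m)%N.
Hypotheses (rbar0 : (0 <= rbar)%R) (abar0 : (0 <= abar)%R) (bbar0 : (0 <= bbar)%R)
  (blow0 : (0 < blow)%R).
Hypotheses (mr : forall t, measurable_fun setT (r t))
  (ma : forall t j, measurable_fun setT (a t j))
  (mb : forall t j, measurable_fun setT (b t j)).
Hypotheses (mr0 : measurable_fun setT r0)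
  (ma0 : forall j, measurable_fun setT (a0 j))
  (mb0 : forall j, measurable_fun setT (b0 j)).
Hypotheses (r_bd : forall t w, (`|r t w| <= rbar)%R)
  (a_bd : forall t j w, (`|a t j w| <= abar)%R)
  (b_bd : forall t j w, (0 <= b t j w <= bbar)%R).
Hypothesis b0_bd : forall j v, (0 <= b0 j v <= bbar)%R.
Hypothesis b0_mean : forall j, blow%:E <= \int[P0]_v (b0 j v)%:E.
Hypothesis law : forall t, (1 <= t <= T)%N ->
  same_law P P0 (r t) (a t) (b t) r0 a0 b0.
Hypothesis indep : mutually_independent P T r a b.

Local Notation eta := (alg_eta T C).
Local Notation W := (alg_W m rbar abar bbar blow).
Local Notation G := (m%:R * (abar + bbar))%R.
Local Notation w0 := (warmup m T rbar abar bbar blow C).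
Local Notation theta := (drift_threshold rbar blow).
Local Notation state n w := (alg_state rbar abar bbar blow T C (fun t => r t w)
  (fun t j => a t j w) (fun t j => b t j w) n).
Local Notation price n w := (state n w).1.
Local Notation ledger n w := (state n w).2.
Local Notation state_space := (fspace R 'I_m * fspace R 'I_m)%type.
Local Notation s := (mgf_rate m bbar blow).

Hypothesis W0 : (0 <= W)%R.

(** The supermartingale step behind both moment bounds: with the state frozen, [F] and [u] are
    constants and [mgf_le1] bounds the integral over the fresh draw. *)
Lemma exp_step n (F : state_space -> R) (u : state_space -> 'I_m -> R) :
  (n < T)%N -> measurable_fun setT F ->
  (forall j, measurable_fun setT (fun x => u x j)) ->
  (forall w, (0 <= F (state n w))%R) ->
  (forall w j, (0 <= u (state n w) j <= 1)%R) ->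
  (forall w, (1 <= \sum_(j < m) u (state n w) j)%R) ->
  \int[P]_w (F (state n w) * expR (s *
     (blow / 2 - \sum_(j < m) u (state n w) j * b n.+1 j w)))%:E <=
  \int[P]_w (F (state n w))%:E.
Proof.
move=> nT mF mu F0 u01 u1.
pose h (z : state_space * fspace R (obs_index m)) : R := (F z.1 * expR (s *
  (blow / 2 - \sum_(j < m) u z.1 j * z.2 (Some (inr j)))))%R.
have mh : measurable_fun setT h.
  apply: measurable_funM; first exact: measurableT_comp mF _.
  apply: measurableT_comp => //; apply: measurable_funM => //.
  apply: measurable_funB => //; apply: measurable_sum => j.
  apply: measurable_funM; first exact: (measurableT_comp (mu j)).
  exact: (measurableT_comp (measurable_coord (Some (inr j))) measurable_snd).
have h0 w y : (0 <= h (state n w, y))%R.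
  by apply: mulr_ge0; [exact: F0|exact: expR_ge0].
have -> := integral_state_obs mr ma mb mr0 ma0 mb0 law indep nT mh
  (fun w => h0 w _) (fun w v => h0 w _).
apply: ge0_le_integral => //.
- by move=> w _; apply: integral_ge0 => v _; rewrite lee_fin.
- by apply: measurable_integral_state_obs.
- apply/measurable_EFinP; apply: (measurableT_comp mF).
  exact: measurable_state_pair.
move=> w _; rewrite /h /=.
under eq_integral do rewrite EFinM.
rewrite ge0_integralZl_EFin//; last first.
- apply/measurable_EFinP; apply: measurableT_comp => //; apply: measurable_funM => //.
  apply: measurable_funB => //; apply: measurable_sum => j.
  by apply: measurable_funM => //; exact: measurable_cst.
rewrite -[leRHS]mule1 lee_wpmul2l ?lee_fin//.
exact: mgf_le1.
Qed.

(** During warm-up the ledger only collects [b], so [exp_step] with [u] the indicator of resource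
    [j] makes this exponential a supermartingale started at 1. *)
Lemma ledger_moment n j : (n <= w0)%N -> (n <= T)%N ->
  \int[P]_w (expR (s * (n%:R * (blow / 2) - ledger n w j)))%:E <= 1.
Proof.
elim: n => [|n IH] nw nT.
  under eq_integral do rewrite /= mul0r subr0 mulr0 expR0.
  by rewrite integral_probability_cst.
pose F (x : state_space) : R := expR (s * (n%:R * (blow / 2) - x.2 j)).
pose u (x : state_space) (i : 'I_m) : R := (i == j)%:R.
have sumu (c : 'I_m -> R) : (\sum_(i < m) (i == j)%:R * c i = c j)%R.
  rewrite (bigD1 j)//= eqxx mul1r big1 ?addr0// => i /negbTE->.
  by rewrite mul0r.
have -> : \int[P]_w (expR (s * (n.+1%:R * (blow / 2) - ledger n.+1 w j)))%:E =
    \int[P]_w (F (state n w) * expR (s *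
      (blow / 2 - \sum_(i < m) u (state n w) i * b n.+1 i w)))%:E.
  apply: eq_integral => w _; congr EFin; rewrite /F -expRD sumu.
  rewrite !ledger_warmup ?(ltnW nw)// big_ord_recr /= -natr1; congr expR; ring.
apply: le_trans (IH (ltnW nw) (ltnW nT)).
apply: exp_step => //.
- apply: measurableT_comp => //; apply: measurable_funM => //.
  apply: measurable_funB => //.
  exact: (measurableT_comp (measurable_coord j) measurable_snd).
- by move=> w; exact: expR_ge0.
- by move=> w i; rewrite /u; case: eqP => _ /=; rewrite ?lexx ler01.
- by move=> w; rewrite (_ : (\sum_(i < m) _)%R = 1%R)// -[RHS](sumu (fun=> 1%R));
    apply: eq_bigr => i _; rewrite mulr1.
Qed.

(** [lambda * eta = s] turns the drift factor of [price_exp_drift] into the one handled by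
    [exp_step]. Each period then adds only the below-threshold constant, whence growth linear in
    [n]. *)
Lemma price_moment n (lambda : R) : (0 < eta)%R -> (eta * G ^+ 2 <= blow)%R ->
  (lambda * eta = s)%R -> (0 <= lambda)%R -> (n <= T)%N ->
  \int[P]_w (expR (lambda * norm2 (price n w)))%:E <=
  (1 + n%:R * expR (lambda * (theta + eta * G)))%:E.
Proof.
move=> e0 eG ls l0; elim: n => [|n IH] nT.
  have N0 : norm2 ((fun=> 0%R) : 'I_m -> R) = 0%R.
    by rewrite /norm2 big1 ?sqrtr0// => j _; rewrite expr0n.
  under eq_integral do rewrite /= N0 mulr0 expR0.
  by rewrite integral_probability_cst mul0r addr0.
have E0 := expR_ge0 (lambda * (theta + eta * G)).
have mE k : measurable_fun setT (fun w => (expR (lambda * norm2 (price k w)))%:E).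
  apply/measurable_EFinP; apply: measurableT_comp => //; apply: measurable_funM => //.
  apply: measurable_norm2.
  by have [] := @measurable_state _ _ R m T rbar abar bbar blow C r a b mr ma mb k.
have [wn|nw] := leqP w0 n; last first.
  have N0 w : norm2 (price n.+1 w) = 0%R.
    by rewrite /norm2 big1 ?sqrtr0// => j _; rewrite price_warmup ?expr0n.
  under eq_integral do rewrite N0 mulr0 expR0.
  rewrite integral_probability_cst lee_fin lerDl.
  by rewrite mulr_ge0.
pose F (x : state_space) : R := expR (lambda * norm2 x.1).
pose u (x : state_space) := direction rbar blow x.1.
have mp1 j : measurable_fun setT (fun x : state_space => x.1 j).
  exact: (measurableT_comp (measurable_coord j) measurable_fst).
have mN : measurable_fun setT (fun x : state_space => norm2 x.1).
  exact: measurable_norm2.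
have mF : measurable_fun setT F.
  by apply: measurableT_comp => //; exact: measurable_funM.
have mu j : measurable_fun setT (fun x => u x j).
  apply: measurable_fun_ifT => //; first exact: measurable_fun_ler.
  apply: measurable_funM => //.
  rewrite (_ : (fun x => _) = (fun x : state_space => powR (norm2 x.1) (-1))).
    exact: measurableT_comp (measurable_powR _) mN.
  by apply/funext => x; rewrite powR_inv1// norm2_ge0.
have step := @exp_step n F u nT mF mu.
have u01 w j : (0 <= u (state n w) j <= 1)%R.
  by apply: direction_itv => // i; exact: price_ge0.
have u1 w : (1 <= \sum_(j < m) u (state n w) j)%R.
  by apply: direction_sum_ge1 => // i; exact: price_ge0.
have FE w : (0 <= F (state n w))%R by exact: expR_ge0.
have {}step := le_trans (step FE u01 u1) (IH (ltnW nT)).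
have mst := measurable_state_pair T mr ma mb rbar abar bbar blow C n.
have mprod : measurable_fun setT (fun w => (F (state n w) * expR (s *
    (blow / 2 - \sum_(j < m) u (state n w) j * b n.+1 j w)))%:E).
  apply/measurable_EFinP; apply: measurable_funM.
    exact: (measurableT_comp mF mst).
  apply: measurableT_comp => //; apply: measurable_funM => //.
  apply: measurable_funB => //; apply: measurable_sum => j.
  apply: measurable_funM => //.
  exact: (measurableT_comp (mu j) mst).
have prod0 w : 0 <= (F (state n w) * expR (s *
    (blow / 2 - \sum_(j < m) u (state n w) j * b n.+1 j w)))%:E.
  by rewrite lee_fin mulr_ge0// expR_ge0.
set k0 := expR (lambda * (theta + eta * G)) in E0 *.
apply: (@le_trans _ _ (\int[P]_w ((F (state n w) * expR (s *
    (blow / 2 - \sum_(j < m) u (state n w) j * b n.+1 j w)))%:E + k0%:E))).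
  apply: ge0_le_integral => //.
  - exact: emeasurable_funD.
  - move=> w _; rewrite -EFinD lee_fin -ls.
    exact: price_exp_drift.
rewrite ge0_integralD//.
have -> : (1 + n.+1%:R * k0 = (1 + n%:R * k0) + k0)%R.
  by rewrite -[n.+1%:R]natr1; ring.
by rewrite integral_probability_cst EFinD leeD2r.
Qed.

Lemma measurable_state_obs_loss : measurable_fun setT
  (fun z : state_space * fspace R (obs_index m) => obs_loss z.1.1 z.2).
Proof.
apply: measurable_obs_loss => i.
  have m1 := measurableT_comp (measurable_coord i) (@measurable_fst _ _ (fspace R 'I_m) (fspace R 'I_m)).
  exact: (measurableT_comp m1 measurable_fst).
exact: (measurableT_comp (measurable_coord i) measurable_snd).
Qed.

Lemma dual_loss_mean k q : (k < T)%N -> (forall j, (0 <= q j)%R) ->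
  \int[P]_w (dual_loss (fun t => r t w) (fun t j => a t j w) (fun t j => b t j w)
    k.+1 q)%:E = expected_dual P0 r0 a0 b0 q.
Proof.
move=> kT q0.
pose h (z : state_space * fspace R (obs_index m)) := obs_loss q z.2.
have mh : measurable_fun setT h.
  apply: measurable_obs_loss => i; first exact: measurable_cst.
  exact: (measurableT_comp (measurable_coord i) measurable_snd).
have := @integral_state_obs _ _ _ _ _ _ _ _ _ _ _ _ _ _ _ mr ma mb mr0 ma0 mb0
  law indep rbar abar bbar blow C k h kT mh.
have h0 x y : (forall j, (0 <= y (Some (inr j)))%R) -> (0 <= h (x, y))%R.
  by move=> y0; exact: obs_loss_ge0.
move=> ->; last 2 first.
- by move=> w; apply: h0 => j; case/andP: (b_bd k.+1 j w).
- by move=> w v; apply: h0 => j; case/andP: (b0_bd j v).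
rewrite /h /= -/(expected_dual P0 r0 a0 b0 q).
rewrite integral_cst// -[RHS]mule1; congr (_ * _); exact: probability_setT.
Qed.

Lemma dual_loss_price_mean k v : (k < T)%N -> (0 <= v)%R ->
  (forall q, (forall j, (0 <= q j)%R) -> v%:E <= expected_dual P0 r0 a0 b0 q) ->
  v%:E <= \int[P]_w (dual_loss (fun t => r t w) (fun t j => a t j w)
    (fun t j => b t j w) k.+1 (price k w))%:E.
Proof.
move=> kT v0 vle.
pose h (z : state_space * fspace R (obs_index m)) := obs_loss z.1.1 z.2.
have h0 w y : (forall j, (0 <= y (Some (inr j)))%R) -> (0 <= h (state k w, y))%R.
  by move=> y0; apply: obs_loss_ge0 => // j; exact: price_ge0.
have hp w v' : (0 <= h (state k w, obs r0 a0 b0 v'))%R.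
  by apply: h0 => j; case/andP: (b0_bd j v').
have := @integral_state_obs _ _ _ _ _ _ _ _ _ _ _ _ _ _ _ mr ma mb mr0 ma0 mb0
  law indep rbar abar bbar blow C k h kT measurable_state_obs_loss.
move=> ->//; last by move=> w; apply: h0 => j; case/andP: (b_bd k.+1 j w).
rewrite -[leLHS](integral_probability_cst P).
apply: ge0_le_integral => //.
  exact: measurable_integral_state_obs measurable_state_obs_loss hp.
by move=> w _; apply: vle => j; exact: price_ge0.
Qed.

End Moments.

(** * Expected regret under sure bounds *)

Section ExpectedRegret.
Local Open Scope ereal_scope.
Context {d d0 : measure_display} {Omega : measurableType d}
  {Omega0 : measurableType d0} {R : realType}.
Variables (P : probability Omega R) (P0 : probability Omega0 R) (m T : nat).
Variables (r : nat -> Omega -> R) (a b : nat -> 'I_m -> Omega -> R).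
Variables (r0 : Omega0 -> R) (a0 b0 : 'I_m -> Omega0 -> R).
Variables (rbar abar bbar blow C : R).
Hypothesis m_gt0 : (0 < m)%N.
Hypotheses (rbar0 : (0 <= rbar)%R) (abar0 : (0 <= abar)%R) (bbar0 : (0 <= bbar)%R)
  (blow0 : (0 < blow)%R).
Hypotheses (mr : forall t, measurable_fun setT (r t))
  (ma : forall t j, measurable_fun setT (a t j))
  (mb : forall t j, measurable_fun setT (b t j)).
Hypotheses (mr0 : measurable_fun setT r0)
  (ma0 : forall j, measurable_fun setT (a0 j))
  (mb0 : forall j, measurable_fun setT (b0 j)).
Hypotheses (r_bd : forall t w, (`|r t w| <= rbar)%R)
  (a_bd : forall t j w, (`|a t j w| <= abar)%R)
  (b_bd : forall t j w, (0 <= b t j w <= bbar)%R).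
Hypothesis r0_bd : forall v, (`|r0 v| <= rbar)%R.
Hypothesis b0_bd : forall j v, (0 <= b0 j v <= bbar)%R.
Hypothesis b0_mean : forall j, blow%:E <= \int[P0]_v (b0 j v)%:E.
Hypothesis law : forall t, (1 <= t <= T)%N ->
  same_law P P0 (r t) (a t) (b t) r0 a0 b0.
Hypothesis indep : mutually_independent P T r a b.

Local Notation eta := (alg_eta T C).
Local Notation W := (alg_W m rbar abar bbar blow).
Local Notation G := (m%:R * (abar + bbar))%R.
Local Notation w0 := (warmup m T rbar abar bbar blow C).
Local Notation theta := (drift_threshold rbar blow).
Local Notation state n w := (alg_state rbar abar bbar blow T C (fun t => r t w)
  (fun t j => a t j w) (fun t j => b t j w) n).
Local Notation price n w := (state n w).1.
Local Notation ledger n w := (state n w).2.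
Local Notation s := (mgf_rate m bbar blow).
Local Notation regret w := (hindsight_opt T (fun t => r t w) (fun t j => a t j w)
    (fun t j => b t j w)
  - alg_reward rbar abar bbar blow T C (fun t => r t w) (fun t j => a t j w)
    (fun t j => b t j w))%R.
Local Notation loss k p w := (dual_loss (fun t => r t w) (fun t j => a t j w)
  (fun t j => b t j w) k p).
Local Notation stockouts w := (\sum_(k < T) (stockout T rbar abar bbar blow C
  (fun t => r t w) (fun t j => a t j w) (fun t j => b t j w) k)%:R)%R.

Hypothesis W0 : (0 <= W)%R.

(** [v] is the infimum of the expected dual over nonnegative prices. Its upper bound [rbar] comes
    from [q = 0], where the loss is the positive part of [r0]. *)
Lemma dual_infimum (e : R) : (0 < e)%R -> exists v : R, [/\ (0 <= v <= rbar)%R,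
  forall q, (forall j, (0 <= q j)%R) -> v%:E <= expected_dual P0 r0 a0 b0 q &
  exists2 q, (forall j, (0 <= q j)%R) &
    expected_dual P0 r0 a0 b0 q <= (v + e)%:E].
Proof.
move=> e0; pose V := [set expected_dual P0 r0 a0 b0 q | q in
  [set q : 'I_m -> R | forall j, (0 <= q j)%R]].
have V0 : 0 <= ereal_inf V.
  apply/ereal_infP => _ [q q0 <-]; apply: integral_ge0 => v _.
  by rewrite lee_fin obs_loss_ge0// => j; case/andP: (b0_bd j v).
have Vr : ereal_inf V <= rbar%:E.
  have : expected_dual P0 r0 a0 b0 (fun=> 0%R) <= rbar%:E.
    rewrite -(integral_probability_cst P0); apply: ge0_le_integral => //.
    - by move=> v _; rewrite lee_fin obs_loss_ge0// => j; case/andP: (b0_bd j v).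
    - apply/measurable_EFinP; apply: measurable_obs_loss => i.
        exact: measurable_cst.
      exact: (measurableT_comp (measurable_coord i) (measurable_obs mr0 ma0 mb0)).
    move=> v _; rewrite lee_fin /obs_loss /dual_loss /inner.
    have z (f : 'I_m -> R) : (\sum_(j < m) 0 * f j = 0)%R.
      by rewrite big1// => j _; rewrite mul0r.
    rewrite !z subr0 addr0 ge_max rbar0 andbT.
    exact: le_trans (ler_norm _) (r0_bd v).
  by apply: le_trans; apply: ereal_inf_lbound; exists (fun=> 0%R).
have Vfin : ereal_inf V \is a fin_num.
  by rewrite ge0_fin_numE// (le_lt_trans Vr)// ltry.
exists (fine (ereal_inf V)); split.
- by rewrite -!lee_fin fineK// V0.
- by move=> q q0; rewrite fineK//; apply: ereal_inf_lbound; exists q.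
have [_ [q q0 <-] /ltW] := lb_ereal_inf_adherent e0 Vfin.
by exists q => //; rewrite EFinD fineK.
Qed.

(** The decisions of the algorithm are themselves feasible competitors. Nonnegativity is what gives
    access to additivity of the integral. *)
Lemma regret_ge0 w : (0 <= regret w)%R.
Proof.
have b_ge0 t j : (0 <= b t j w)%R by case/andP: (b_bd t j w).
pose x := [ffun k : 'I_T => alg_x rbar abar bbar blow T C (fun t => r t w)
  (fun t j => a t j w) (fun t j => b t j w) k.+1].
have xE : (x : 'I_T -> bool) = (fun k => alg_x rbar abar bbar blow T C
    (fun t => r t w) (fun t j => a t j w) (fun t j => b t j w) k.+1).
  by apply/funext => k; rewrite ffunE.
rewrite subr_ge0.
have -> : alg_reward rbar abar bbar blow T C (fun t => r t w) (fun t j => a t j w)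
    (fun t j => b t j w) = reward (fun t => r t w) x by rewrite xE.
apply: (le_bigmax_cond _ (fun y : {ffun 'I_T -> bool} => reward (fun t => r t w) y)).
by apply/asboolP; rewrite xE; exact: algorithm_feasible.
Qed.

(** Covers also a warm-up longer than the horizon, where the left side is nonpositive. *)
Lemma sum_tail_ge (v : R) n : (0 <= v)%R ->
  (n%:R * v - w0%:R * v <= \sum_(k < n | (w0 <= k)%N) v)%R.
Proof.
move=> v0; elim: n => [|n IH].
  by rewrite big_ord0 mul0r sub0r oppr_le0 mulr_ge0.
rewrite (sum_ord_recr_cond (fun=> v)) -[n.+1%:R]natr1 mulrDl mul1r.
case: leqP => [wn|nw]; first by lra.
have : (n.+1%:R * v <= w0%:R * v)%R by rewrite ler_wpM2r// ler_nat.
rewrite -[n.+1%:R]natr1 addr0 => h.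
have : (0 <= \sum_(k < n | (w0 <= k)%N) v)%R by exact: sumr_ge0.
lra.
Qed.

(** [H] is a measurable majorant of the stockout count, so that only [H] has to be integrated. *)
Lemma expected_regret_le (H : Omega -> R) (S : R) : (0 < T)%N -> (0 < eta)%R ->
  measurable_fun setT H -> (forall w, (0 <= H w)%R) ->
  (forall w, (stockouts w <= H w)%R) ->
  \int[P]_w (H w)%:E <= S%:E ->
  \int[P]_w (regret w)%:E <=
  (w0%:R * rbar + 1 + rbar * S + T%:R * eta * G ^+ 2 / 2)%:E.
Proof.
move=> T0 e0 mH H0 NH HS.
have T0' : (0 < T%:R :> R)%R by rewrite ltr0n.
(* With tolerance [1 / T] per period, the near-minimizer costs 1 in total. *)
have [|v [/andP[v0 vr] vle [q q0 qv]]] := @dual_infimum (T%:R^-1)%R.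
  by rewrite invr_gt0.
pose F w := (\sum_(k < T | (w0 <= k)%N) loss k.+1 (price k w) w)%R.
pose U w := (\sum_(k < T) loss k.+1 q w)%R.
pose c := (T%:R * eta * G ^+ 2 / 2)%R.
have c0 : (0 <= c)%R.
  apply: divr_ge0 => //; apply: mulr_ge0; last exact: sqr_ge0.
  by apply: mulr_ge0 => //; exact: ltW.
have loss0 k p w : (forall j, (0 <= p j)%R) -> (0 <= loss k p w)%R.
  move=> p0; rewrite addr_ge0// ?le_max ?lexx ?orbT// sumr_ge0// => j _.
  by rewrite mulr_ge0//; case/andP: (b_bd k j w).
have price0 k w j : (0 <= price k w j)%R by exact: price_ge0.
have F0 w : (0 <= F w)%R by apply: sumr_ge0 => k _; exact: loss0.
have U0 w : (0 <= U w)%R by apply: sumr_ge0 => k _; exact: loss0.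
have mobs t : measurable_fun setT (obs (r t) (a t) (b t)) by exact: measurable_obs.
have mlossF k : measurable_fun setT (fun w => loss k.+1 (price k w) w).
  have [mp _] := @measurable_state _ _ R m T rbar abar bbar blow C r a b mr ma mb k.
  apply: (measurable_obs_loss (y := obs (r k.+1) (a k.+1) (b k.+1))) => // i.
  exact: (measurableT_comp (measurable_coord i)).
have mlossU k : measurable_fun setT (fun w => loss k.+1 q w).
  apply: (measurable_obs_loss (p := fun=> q)
    (y := obs (r k.+1) (a k.+1) (b k.+1))) => // i.
  exact: (measurableT_comp (measurable_coord i)).
have mF : measurable_fun setT F by exact: measurable_sum_cond.
have mU : measurable_fun setT U by exact: measurable_sum.
have mD : measurable_fun setT (fun w => regret w).
  apply: measurable_funB; first exact: measurable_hindsight_opt.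
  exact: measurable_alg_reward.
have pointwise w : (regret w + F w <= U w + (rbar * H w + c))%R.
  have := @regret_le R m T rbar abar bbar blow C (fun t => r t w)
    (fun t j => a t j w) (fun t j => b t j w) W0 blow0 abar0
    (fun t => r_bd t w) (fun t j => a_bd t j w) (fun t j => b_bd t j w) q q0.
  rewrite -/(F w) -/(U w) => main.
  have := ler_wpM2l rbar0 (NH w) => rH.
  have e2 : (0 < 2 * eta)%R by rewrite mulr_gt0.
  rewrite -(ler_pM2l e2); apply: (le_trans main).
  have := ler_wpM2l (ltW e2) rH.
  have -> : (T%:R * (eta * G) ^+ 2 = 2 * eta * c)%R by rewrite /c; field.
  lra.
have FE : (\sum_(k < T | (w0 <= k)%N) v)%R%:E <= \int[P]_w (F w)%:E.
  rewrite /F -sumEFin; under eq_integral do rewrite -sumEFin.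
  under eq_integral do rewrite -big_filter.
  rewrite ge0_integral_sum//; last 2 first.
  - by move=> k; apply/measurable_EFinP.
  - by move=> k w _; rewrite lee_fin loss0.
  rewrite big_filter; apply: lee_sum => k _.
  exact: (dual_loss_price_mean C blow0 mr ma mb mr0 ma0 mb0 b_bd b0_bd law indep W0).
have UE : \int[P]_w (U w)%:E <= (T%:R * v + 1)%:E.
  rewrite /U; under eq_integral do rewrite -sumEFin.
  rewrite ge0_integral_sum//; last 2 first.
  - by move=> k; apply/measurable_EFinP.
  - by move=> k w _; rewrite lee_fin loss0.
  apply: (@le_trans _ _ (\sum_(k < T) (v + T%:R^-1)%:E)).
    apply: lee_sum => k _.
    by rewrite (dual_loss_mean rbar abar blow C mr ma mb mr0 ma0 mb0 b_bd b0_bd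
      law indep).
  rewrite sumEFin sumr_const card_ord lee_fin -[leLHS]mulr_natl mulrDr mulfV//.
  by rewrite gt_eqF.
have nv := sum_tail_ge T v0.
have : \int[P]_w ((regret w)%:E + (F w)%:E) <=
    \int[P]_w ((U w)%:E + ((rbar * H w)%:E + c%:E)).
  apply: ge0_le_integral => //.
  - by move=> w _; rewrite -EFinD lee_fin addr_ge0// regret_ge0.
  - by apply: emeasurable_funD; exact/measurable_EFinP.
  - apply: emeasurable_funD; first exact/measurable_EFinP.
    apply: emeasurable_funD; apply/measurable_EFinP; last exact: measurable_cst.
    by apply: measurable_funM => //; exact: measurable_cst.
  - by move=> w _; rewrite -!EFinD lee_fin.
rewrite ge0_integralD//; last 4 first.
- by move=> w _; rewrite lee_fin regret_ge0.
- exact/measurable_EFinP.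
- by move=> w _; rewrite lee_fin.
- exact/measurable_EFinP.
rewrite ge0_integralD//; last 4 first.
- by move=> w _; rewrite lee_fin.
- exact/measurable_EFinP.
- by move=> w _; rewrite -EFinD lee_fin addr_ge0// mulr_ge0.
- apply: emeasurable_funD; apply/measurable_EFinP; last exact: measurable_cst.
  by apply: measurable_funM => //; exact: measurable_cst.
rewrite ge0_integralD//; last 2 first.
- by move=> w _; rewrite lee_fin mulr_ge0.
- by apply/measurable_EFinP; apply: measurable_funM => //; exact: measurable_cst.
rewrite integral_probability_cst.
under [X in _ <= _ + (X + _)]eq_integral do rewrite EFinM.
rewrite ge0_integralZl_EFin//; last 2 first.
- by move=> w _; rewrite lee_fin.
- exact/measurable_EFinP.
move=> main.
have {}main : \int[P]_w (regret w)%:E + (T%:R * v - w0%:R * v)%:E <=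
    (T%:R * v + 1)%:E + (rbar%:E * S%:E + c%:E).
  apply: (le_trans (leeD2l _ (le_trans _ FE))); first by rewrite lee_fin.
  apply: (le_trans main); apply: leeD => //; apply: leeD2r.
  by apply: lee_wpmul2l.
move: main; rewrite -EFinM -!EFinD -leeBrDr// -EFinB => /le_trans; apply.
rewrite lee_fin -/c.
have : (w0%:R * v <= w0%:R * rbar)%R by rewrite ler_wpM2l.
lra.
Qed.

Lemma expected_stockouts (lambda : R) : (0 < eta)%R -> (eta * abar <= W / 2)%R ->
  (eta * G ^+ 2 <= blow)%R -> (lambda * eta = s)%R -> (0 <= lambda)%R ->
  exists H : Omega -> R, [/\ measurable_fun setT H, (forall w, (0 <= H w)%R),
    (forall w, (stockouts w <= H w)%R) &
    \int[P]_w (H w)%:E <= (T%:R *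
      (T%:R * ((1 + T%:R * expR (lambda * (theta + eta * G))) * expR (- (lambda * W)))
       + m%:R * expR (lambda * (3 / 2 * W) - s * (w0%:R * (blow / 2)))))%:E].
Proof.
move=> e0 ea eG ls l0.
set A := expR (lambda * (theta + eta * G)).
set B := expR (- (lambda * W)).
set D := expR (_ - _).
have A0 : (0 <= A)%R by exact: expR_ge0.
have B0 : (0 <= B)%R by exact: expR_ge0.
have D0 : (0 <= D)%R by exact: expR_ge0.
(* If the warm-up fills the horizon, there is no active period. Otherwise [w0 < T], so
   [ledger_moment] applies at time [w0]. *)
have [Tw|wT] := leqP T w0.
  exists (fun=> 0%R); split=> //.
    move=> w; rewrite big1// => k _.
    by rewrite /stockout leqNgt (leq_trans (ltn_ord k) Tw).
  by rewrite integral0 lee_fin mulr_ge0// addr_ge0// !mulr_ge0// addr_ge0// mulr_ge0.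
pose Hp k w := expR (lambda * norm2 (price k w)).
pose Hl j w := expR (s * (w0%:R * (blow / 2) - ledger w0 w j)).
pose H w := (T%:R * (\sum_(k < T) Hp k w * B + \sum_(j < m) Hl j w * D))%R.
have mHp k : measurable_fun setT (Hp k).
  apply: measurableT_comp => //; apply: measurable_funM => //.
  apply: measurable_norm2.
  by have [] := @measurable_state _ _ R m T rbar abar bbar blow C r a b mr ma mb k.
have mHl j : measurable_fun setT (Hl j).
  apply: measurableT_comp => //; apply: measurable_funM => //.
  apply: measurable_funB => //.
  by have [_] := @measurable_state _ _ R m T rbar abar bbar blow C r a b mr ma mb w0.
have Hp0 k w : (0 <= Hp k w)%R by exact: expR_ge0.
have Hl0 j w : (0 <= Hl j w)%R by exact: expR_ge0.
have mHpB k : measurable_fun setT (fun w => Hp k w * B)%R.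
  by apply: measurable_funM => //; exact: measurable_cst.
have mHlD j : measurable_fun setT (fun w => Hl j w * D)%R.
  by apply: measurable_funM => //; exact: measurable_cst.
have mSp : measurable_fun setT (fun w => \sum_(k < T) Hp k w * B)%R.
  exact: measurable_sum.
have mSl : measurable_fun setT (fun w => \sum_(j < m) Hl j w * D)%R.
  exact: measurable_sum.
have Sp0 w : (0 <= \sum_(k < T) Hp k w * B)%R.
  by apply: sumr_ge0 => k _; rewrite mulr_ge0.
have Sl0 w : (0 <= \sum_(j < m) Hl j w * D)%R.
  by apply: sumr_ge0 => j _; rewrite mulr_ge0.
exists H; split.
- apply: measurable_funM; first exact: measurable_cst.
  exact: measurable_funD.
- by move=> w; rewrite mulr_ge0// addr_ge0.
- move=> w.
  apply: le_trans (stockouts_le (fun t => r t w) (fun t j => b t j w) W0 blow0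
    (fun t j => a_bd t j w) e0 ea l0) _.
  rewrite ler_wpM2l//; apply: lerD.
    rewrite big_mkcond; apply: ler_sum => k _; case: ifP => _.
      by rewrite /Hp /B -expRD mulrBr.
    by rewrite mulr_ge0.
  apply: ler_sum => j _; rewrite /Hl /D -expRD ler_expR -ls.
  by rewrite le_eqVlt; apply/orP; left; apply/eqP; ring.
rewrite /H; under eq_integral do rewrite EFinM.
rewrite ge0_integralZl_EFin//; last 2 first.
- by move=> w _; rewrite lee_fin addr_ge0.
- by apply/measurable_EFinP; exact: measurable_funD.
rewrite EFinM; apply: lee_wpmul2l => //.
under eq_integral do rewrite EFinD.
rewrite ge0_integralD//; last 4 first.
- by move=> w _; rewrite lee_fin.
- exact/measurable_EFinP.
- by move=> w _; rewrite lee_fin.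
- exact/measurable_EFinP.
rewrite EFinD; apply: leeD.
  under eq_integral do rewrite -sumEFin.
  rewrite ge0_integral_sum//; last 2 first.
  - by move=> k; exact/measurable_EFinP.
  - by move=> k w _; rewrite lee_fin mulr_ge0.
  apply: (@le_trans _ _ (\sum_(k < T) ((1 + T%:R * A) * B)%:E)); last first.
    by rewrite sumEFin sumr_const card_ord lee_fin -[leLHS]mulr_natl.
  apply: lee_sum => k _; under eq_integral do rewrite mulrC EFinM.
  rewrite ge0_integralZl_EFin//; last 2 first.
  - by move=> w _; rewrite lee_fin.
  - exact/measurable_EFinP.
  rewrite mulrC EFinM; apply: lee_wpmul2l => //.
  have := price_moment m_gt0 rbar0 abar0 bbar0 blow0 mr ma mb mr0 ma0 mb0 r_bd
    a_bd b_bd b0_bd b0_mean law indep W0 e0 eG ls l0 (ltnW (ltn_ord k)).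
  move=> /le_trans; apply; rewrite lee_fin lerD2l ler_wpM2r// ler_nat.
  exact: ltnW.
under eq_integral do rewrite -sumEFin.
rewrite ge0_integral_sum//; last 2 first.
- by move=> j; exact/measurable_EFinP.
- by move=> j w _; rewrite lee_fin mulr_ge0.
apply: (@le_trans _ _ (\sum_(j < m) D%:E)); last first.
  by rewrite sumEFin sumr_const card_ord lee_fin -[leLHS]mulr_natl.
apply: lee_sum => j _; under eq_integral do rewrite mulrC EFinM.
rewrite ge0_integralZl_EFin//; last 2 first.
- by move=> w _; rewrite lee_fin.
- exact/measurable_EFinP.
rewrite -[leRHS]mule1; apply: lee_wpmul2l => //.
exact: (ledger_moment bbar0 blow0 mr ma mb mr0 ma0 mb0 b0_bd b0_mean law indep W0 j
  (leqnn _) (ltnW wT)).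
Qed.

End ExpectedRegret.

(** * Constants *)

Section HorizonScale.
Variables (R : realType) (T : nat).
Hypothesis T2 : (2 <= T)%N.

Definition scale : R := Num.sqrt (9 * T%:R * ln T%:R).

Lemma ln_ge_half : 1 / 2 <= ln (T%:R : R).
Proof.
have h : ln (1 + - (1 / 2) : R) <= - (1 / 2) by apply: le_ln1Dx; lra.
have e : (1 + - (1 / 2) : R) = 2^-1 by field.
have := h; rewrite e lnV ?posrE// => h2.
have : ln (2 : R) <= ln T%:R by rewrite ler_ln ?posrE ?ltr0n ?ler_nat//; lia.
lra.
Qed.

Lemma natr_gt0 : 0 < (T%:R : R). Proof. by rewrite ltr0n; lia. Qed.

Lemma natr_ge1 : 1 <= (T%:R : R). Proof. by rewrite ler1n (leq_trans _ T2). Qed.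

Lemma scale_sq : scale ^+ 2 = 9 * T%:R * ln T%:R.
Proof.
rewrite sqr_sqrtr// !mulr_ge0// ?ler0n//.
by apply: le_trans ln_ge_half; lra.
Qed.

Lemma sqrt_sq : Num.sqrt (T%:R : R) ^+ 2 = T%:R.
Proof. by rewrite sqr_sqrtr// ler0n. Qed.

Lemma sqrt_ge1 : 1 <= Num.sqrt (T%:R : R).
Proof. by rewrite -[leLHS]sqrtr1 ler_sqrt ?ler0n// ler1n; lia. Qed.

Lemma sqrt_le_scale : Num.sqrt (T%:R : R) <= scale.
Proof.
have l := ln_ge_half.
rewrite ler_sqrt; last by rewrite !mulr_ge0// ?ler0n//; lra.
have t0 := natr_gt0; have := ler_wpM2l (ltW t0) l; lra.
Qed.

Lemma scale_gt0 : 0 < scale.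
Proof. exact: lt_le_trans (lt_le_trans ltr01 sqrt_ge1) sqrt_le_scale. Qed.

(** After squaring this is [9 <= 25 * ln T], which follows from [ln T >= 1 / 2]. *)
Lemma scale_le : scale <= 5 * (Num.sqrt T%:R * ln T%:R).
Proof.
have l := ln_ge_half; have q := sqrt_ge1.
have p0 : 0 <= 5 * (Num.sqrt T%:R * ln T%:R) :> R by rewrite !mulr_ge0//; lra.
rewrite -(@ler_pXn2r _ 2)// ?nnegrE ?(ltW scale_gt0)// scale_sq.
rewrite !exprMn sqrt_sq.
have Tl : 0 <= T%:R * ln T%:R :> R by rewrite mulr_ge0// ?(ltW natr_gt0)//; lra.
have := ler_wpM2l Tl l; lra.
Qed.

Lemma alg_etaE : alg_eta T 9 = scale^-1. Proof. by []. Qed.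

(** Sixth powers turn [sqrt T] into [T ^ 3]: [exp (c * scale)] is the sixth power of
    [exp (c / 6 * scale) >= c / 6 * sqrt T]. *)
Lemma expR_decay (c : R) : 0 < c ->
  T%:R ^+ 3 * expR (- (c * scale)) <= (6 / c) ^+ 6.
Proof.
move=> c0; have t0 := natr_gt0.
have c6 : 0 < c / 6 by rewrite divr_gt0.
have h1 : c / 6 * Num.sqrt T%:R <= expR (c / 6 * scale).
  apply: (@le_trans _ _ (1 + c / 6 * scale)); last exact: expR_ge1Dx.
  have := ler_wpM2l (ltW c6) sqrt_le_scale; lra.
have p0 : 0 <= c / 6 * Num.sqrt (T%:R : R) by rewrite mulr_ge0 ?sqrtr_ge0// ltW.
have h2 : (c / 6 * Num.sqrt T%:R) ^+ 6 <= expR (c * scale).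
  have -> : expR (c * scale) = expR (c / 6 * scale) ^+ 6.
    by rewrite -expRM_natl; congr expR; field.
  by rewrite lerXn2r ?nnegrE ?expR_ge0.
have e : (c / 6 * Num.sqrt T%:R) ^+ 6 = T%:R ^+ 3 / (6 / c) ^+ 6 :> R.
  have sq6 : Num.sqrt T%:R ^+ 6 = T%:R ^+ 3 :> R.
    by rewrite -[6%N]/(2 * 3)%N exprM sqrt_sq.
  by rewrite exprMn sq6 mulrC -[in RHS]exprVn invf_div.
have d0 : 0 < (6 / c) ^+ 6 by rewrite exprn_gt0// divr_gt0.
rewrite expRN ler_pdivrMr ?expR_gt0// mulrC -ler_pdivrMr//.
by rewrite -e.
Qed.

End HorizonScale.

Section Constants.
Variables (R : realType) (m : nat) (rbar abar bbar blow : R).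
Hypotheses (m_gt0 : (0 < m)%N) (rbar0 : 0 < rbar) (abar0 : 0 < abar)
  (bbar0 : 0 < bbar) (blow0 : 0 < blow).

Local Notation W := (alg_W m rbar abar bbar blow).
Local Notation theta := (drift_threshold rbar blow).
Local Notation G := (m%:R * (abar + bbar)).
Local Notation s := (mgf_rate m bbar blow).

(** Here [2 * theta = 4 * rbar / blow + 2]: the 2 is the additive term of [W], and the rest is below
    the first entry of its maximum because [sqrt m >= 1]. *)
Lemma alg_W_ge : 2 * theta <= W.
Proof.
have rb : 0 <= rbar / blow by rewrite divr_ge0// ltW.
have sm : 1 <= Num.sqrt (m%:R : R).
  by rewrite -[leLHS]sqrtr1 ler_sqrt ?ler0n// ler1n.
rewrite /drift_threshold mulrDr mulr1 addrC /alg_W lerD2l.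
apply: le_trans (ceil_ge _); rewrite le_max; apply/orP; left.
have -> : 8 * Num.sqrt m%:R * rbar / blow = 8 * (Num.sqrt m%:R * (rbar / blow)).
  by rewrite -!mulrA.
have : rbar / blow <= Num.sqrt m%:R * (rbar / blow).
  by rewrite -[leLHS]mul1r ler_wpM2r.
by rewrite -mulrA; lra.
Qed.

Lemma alg_W_ge2 : 2 <= W.
Proof.
apply: le_trans alg_W_ge; rewrite -[leLHS]mulr1 ler_wpM2l//.
by apply: drift_threshold_ge1 => //; exact: ltW.
Qed.

Variable T : nat.
Hypothesis T2 : (2 <= T)%N.

Local Notation w0 := (warmup m T rbar abar bbar blow 9).
Local Notation scale := (scale R T).

Lemma warmup_bounds : 4 * W * scale / blow <= w0%:R <= 4 * W * scale / blow + 1.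
Proof.
have W0 : 0 <= W by apply: le_trans alg_W_ge2; lra.
have x0 : 0 <= 4 * W * scale / blow.
  by rewrite divr_ge0 ?mulr_ge0 ?(ltW (scale_gt0 R T2))// ltW.
rewrite -kappaE// /alg_kappa -/scale ceil_ge/=.
by have := ceilB1_lt (4 * W * scale / blow); rewrite intrB; lra.
Qed.

(** Up to the factor [exp (s * G)], both exponentials are at most [exp (- lambda)]. For prices,
    [W - theta >= theta >= 1]; for stock, the warm-up length gives
    [3 / 2 * W - 2 * W = - W / 2 <= - 1] in units of [lambda]. The powers of [T] total at most 3 and
    fall to [expR_decay]. *)
Lemma stockout_bound (lambda : R) : lambda = s * scale ->
  (T%:R * (T%:R * ((1 + T%:R * expR (lambda * (theta + scale^-1 * G)))
       * expR (- (lambda * W)))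
     + m%:R * expR (lambda * (3 / 2 * W) - s * (w0%:R * (blow / 2)))))
  <= (2 * expR (s * G) + m%:R) * (6 / s) ^+ 6.
Proof.
move=> lE; have t0 := (natr_gt0 R T2); have L0 := (scale_gt0 R T2).
have s0 : 0 < s by apply: mgf_rate_gt0 => //; exact: ltW.
have l0 : 0 < lambda by rewrite lE mulr_gt0.
have W2 := alg_W_ge2; have Wth := alg_W_ge.
have th1 : 1 <= theta by apply: drift_threshold_ge1 => //; exact: ltW.
have G0 : 0 <= G by rewrite mulr_ge0// addr_ge0// ltW.
set E := expR (- lambda).
have E0 : 0 < E by exact: expR_gt0.
set X := expR (s * G).
have X0 : 0 < X by exact: expR_gt0.
have T1 := natr_ge1 R T2.
have h1 : (1 + T%:R * expR (lambda * (theta + scale^-1 * G)))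
    * expR (- (lambda * W)) <= 2 * T%:R * X * E.
  set A := expR (lambda * (theta + _)).
  have A1 : 1 <= A.
    rewrite -expR0 ler_expR mulr_ge0 ?(ltW l0)// addr_ge0//; first lra.
    by rewrite mulr_ge0// invr_ge0 ltW.
  have AB : A * expR (- (lambda * W)) <= X * E.
    rewrite -!expRD ler_expR.
    have -> : lambda * (theta + scale^-1 * G) = lambda * theta + s * G.
      by rewrite lE; field; rewrite gt_eqF.
    have h : 1 <= W - theta by lra.
    by have := ler_wpM2l (ltW l0) h; lra.
  have TA : 1 <= T%:R * A by rewrite -[leLHS]mulr1 ler_pM.
  apply: (@le_trans _ _ (2 * T%:R * (A * expR (- (lambda * W))))).
    rewrite mulrA ler_wpM2r ?expR_ge0//; lra.
  by rewrite -[leRHS]mulrA ler_wpM2l// mulr_ge0// ltW.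
have h2 : expR (lambda * (3 / 2 * W) - s * (w0%:R * (blow / 2))) <= E.
  rewrite ler_expR; have /andP[wb _] := warmup_bounds.
  have wb2 : 4 * W * scale <= w0%:R * blow by rewrite -ler_pdivrMr.
  have := ler_wpM2l (ltW s0) wb2.
  have -> : s * (4 * W * scale) = 4 * (lambda * W) by rewrite lE; ring.
  have h : 2 <= W by [].
  by have := ler_wpM2l (ltW l0) h; lra.
have h3 := expR_decay T2 s0.
rewrite -lE -/E in h3.
apply: (@le_trans _ _ ((2 * X + m%:R) * (T%:R ^+ 3 * E))); last first.
  by rewrite ler_wpM2l// addr_ge0// mulr_ge0// ltW.
have T13 : T%:R <= T%:R ^+ 3 :> R by rewrite -[leLHS]expr1 ler_weXn2l.
apply: (@le_trans _ _ (T%:R * (T%:R * (2 * T%:R * X * E) + m%:R * E))).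
  by rewrite ler_wpM2l ?(ltW t0)// lerD// ler_wpM2l// ltW.
have mE : 0 <= m%:R * E by rewrite mulr_ge0// ltW.
have := ler_wpM2r mE T13.
have -> : T%:R * (T%:R * (2 * T%:R * X * E) + m%:R * E) =
  2 * X * (T%:R ^+ 3 * E) + T%:R * (m%:R * E) by ring.
have -> : (2 * X + m%:R) * (T%:R ^+ 3 * E) =
  2 * X * (T%:R ^+ 3 * E) + T%:R ^+ 3 * (m%:R * E) by ring.
lra.
Qed.

(** The first summand serves horizons with a small step size, the second the short horizons that
    violate one of the two step-size conditions. *)
Definition stockout_const : R :=
  (2 * expR (s * G) + m%:R) * (6 / s) ^+ 6 + (G ^+ 2 / blow + abar).

(** Coefficients of [sqrt T * ln T]: 20 is the 4 of the warm-up length times the 5 of [scale_le];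
    the factors 2 absorb [1 <= sqrt T <= 2 * sqrt T * ln T]. *)
Definition regret_const : R :=
  20 * W * rbar / blow + 2 * rbar + 2 + 2 * rbar * stockout_const + G ^+ 2.

Lemma regret_bound (S : R) : S <= stockout_const * Num.sqrt T%:R ->
  w0%:R * rbar + 1 + rbar * S + T%:R * scale^-1 * G ^+ 2 / 2
  <= regret_const * Num.sqrt T%:R * ln T%:R ^+ 1.
Proof.
move=> HS; have l := (ln_ge_half R T2); have q := (sqrt_ge1 R T2); have L0 := (scale_gt0 R T2).
have t0 := (natr_gt0 R T2); rewrite expr1 -(mulrA regret_const).
set q' := Num.sqrt _ in HS q *; set y := q' * ln T%:R.
have q0 : 0 <= q' by lra.
have qy : q' <= 2 * y by have := ler_wpM2l q0 l; rewrite -/y; lra.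
have y0 : 0 <= y by lra.
have W0 : 0 <= W by apply: le_trans alg_W_ge2; lra.
have S1 : rbar * S <= 2 * rbar * stockout_const * y.
  have c0 : 0 <= stockout_const.
    have s0 : 0 < s by apply: mgf_rate_gt0 => //; exact: ltW.
    apply: addr_ge0; last by rewrite addr_ge0 ?(ltW abar0)// divr_ge0 ?sqr_ge0// ltW.
    apply: mulr_ge0; last by rewrite exprn_ge0// divr_ge0// ltW.
    by rewrite addr_ge0// mulr_ge0// expR_ge0.
  have := ler_wpM2l (ltW rbar0) HS.
  by have := ler_wpM2l (ltW rbar0) (ler_wpM2l c0 qy); lra.
have ws : w0%:R * rbar <= 20 * W * rbar / blow * y + 2 * rbar * y.
  have /andP[_ wb] := warmup_bounds.
  have Wb : 0 <= 4 * W / blow by rewrite divr_ge0 ?mulr_ge0// ltW.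
  have h := ler_wpM2l Wb (scale_le R T2); rewrite -/q' -/y in h.
  have h2 : w0%:R <= 20 * W / blow * y + 2 * y.
    apply: (le_trans wb); rewrite lerD//; last lra.
    have -> : 4 * W * scale / blow = 4 * W / blow * scale by ring.
    by apply: (le_trans h); rewrite le_eqVlt; apply/orP; left; apply/eqP; ring.
  have := ler_wpM2r (ltW rbar0) h2.
  have -> : (20 * W / blow * y + 2 * y) * rbar =
    20 * W * rbar / blow * y + 2 * rbar * y by ring.
  by [].
have cs : T%:R * scale^-1 * G ^+ 2 / 2 <= G ^+ 2 * y.
  have TL : T%:R * scale^-1 <= q'.
    rewrite ler_pdivrMr// -[leLHS](sqrt_sq R T) -/q' expr2 ler_wpM2l//.
    exact: (sqrt_le_scale R T2).
  have := ler_wpM2r (sqr_ge0 G) TL.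
  by have := ler_wpM2r (sqr_ge0 G) qy; lra.
have o1 : 1 <= 2 * y by lra.
rewrite /regret_const; lra.
Qed.

End Constants.

(** * Regret bound under sure bounds, with all constants chosen *)

Section BoundedRegret.
Local Open Scope ereal_scope.
Context {d d0 : measure_display} {Omega : measurableType d}
  {Omega0 : measurableType d0} {R : realType}.
Variables (P : probability Omega R) (P0 : probability Omega0 R) (m T : nat).
Variables (r : nat -> Omega -> R) (a b : nat -> 'I_m -> Omega -> R).
Variables (r0 : Omega0 -> R) (a0 b0 : 'I_m -> Omega0 -> R).
Variables (rbar abar bbar blow : R).
Hypothesis m_gt0 : (0 < m)%N.
Hypotheses (rbar0 : (0 < rbar)%R) (abar0 : (0 < abar)%R) (bbar0 : (0 < bbar)%R)
  (blow0 : (0 < blow)%R).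
Hypotheses (mr : forall t, measurable_fun setT (r t))
  (ma : forall t j, measurable_fun setT (a t j))
  (mb : forall t j, measurable_fun setT (b t j)).
Hypotheses (mr0 : measurable_fun setT r0)
  (ma0 : forall j, measurable_fun setT (a0 j))
  (mb0 : forall j, measurable_fun setT (b0 j)).
Hypotheses (r_bd : forall t w, (`|r t w| <= rbar)%R)
  (a_bd : forall t j w, (`|a t j w| <= abar)%R)
  (b_bd : forall t j w, (0 <= b t j w <= bbar)%R).
Hypothesis r0_bd : forall v, (`|r0 v| <= rbar)%R.
Hypothesis b0_bd : forall j v, (0 <= b0 j v <= bbar)%R.
Hypothesis b0_mean : forall j, blow%:E <= \int[P0]_v (b0 j v)%:E.
Hypothesis law : forall t, (1 <= t <= T)%N ->
  same_law P P0 (r t) (a t) (b t) r0 a0 b0.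
Hypothesis indep : mutually_independent P T r a b.
Hypothesis T2 : (2 <= T)%N.

Local Notation G := (m%:R * (abar + bbar))%R.
Local Notation W := (alg_W m rbar abar bbar blow).
Local Notation s := (mgf_rate m bbar blow).

Lemma bounded_regret :
  \int[P]_w (hindsight_opt T (fun t => r t w) (fun t j => a t j w) (fun t j => b t j w)
    - alg_reward rbar abar bbar blow T 9 (fun t => r t w) (fun t j => a t j w)
        (fun t j => b t j w))%:E
  <= (regret_const m rbar abar bbar blow * Num.sqrt T%:R * ln T%:R ^+ 1)%:E.
Proof.
have W2 : (2 <= W)%R by exact: alg_W_ge2.
have W0 : (0 <= W)%R by exact: le_trans W2.
have L0 : (0 < scale R T)%R by exact: scale_gt0.
have e0 : (0 < alg_eta T 9 :> R)%R by rewrite alg_etaE invr_gt0.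
have T0 : (0 < T)%N by exact: ltn_trans T2.
have q1 : (1 <= Num.sqrt (T%:R : R))%R by exact: sqrt_ge1.
have s0 : (0 < s)%R by apply: mgf_rate_gt0 => //; exact: ltW.
pose K1 := ((2 * expR (s * G) + m%:R) * (6 / s) ^+ 6)%R.
pose K2 := (G ^+ 2 / blow + abar)%R.
have K10 : (0 <= K1)%R.
  apply: mulr_ge0; last by rewrite exprn_ge0// divr_ge0// ltW.
  by rewrite addr_ge0// mulr_ge0// expR_ge0.
have K20 : (0 <= K2)%R by rewrite addr_ge0 ?(ltW abar0)// divr_ge0 ?sqr_ge0// ltW.
suff [H [S [mH H0 NH HS SK]]] : exists (H : Omega -> R) (S : R),
    [/\ measurable_fun setT H, (forall w, (0 <= H w)%R),
     (forall w, (\sum_(k < T) (stockout T rbar abar bbar blow 9 (fun t => r t w)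
        (fun t j => a t j w) (fun t j => b t j w) k)%:R <= H w)%R),
     \int[P]_w (H w)%:E <= S%:E &
     (S <= stockout_const m abar bbar blow * Num.sqrt T%:R)%R].
  apply: le_trans (expected_regret_le (ltW rbar0) (ltW abar0) blow0 mr ma mb mr0 ma0
    mb0 r_bd a_bd b_bd r0_bd b0_bd law indep W0 T0 e0 mH H0 NH HS) _.
  by rewrite lee_fin; exact: regret_bound.
have [/andP[ea eG]|bad] :=
  boolP ((alg_eta T 9 * abar <= W / 2) && (alg_eta T 9 * G ^+ 2 <= blow))%R.
  have ls : (s * scale R T * alg_eta T 9 = s)%R.
    by rewrite alg_etaE mulfK// gt_eqF.
  have l0 : (0 <= s * scale R T)%R by rewrite mulr_ge0// ltW.
  have [H [mH H0 NH HS]] := expected_stockouts m_gt0 (ltW rbar0) (ltW abar0)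
    (ltW bbar0) blow0 mr ma mb mr0 ma0 mb0 r_bd a_bd b_bd b0_bd b0_mean law indep
    W0 e0 ea eG ls l0.
  exists H; eexists; split; [exact: mH|exact: H0|exact: NH|exact: HS|].
  rewrite alg_etaE.
  have h := stockout_bound m_gt0 rbar0 abar0 bbar0 blow0 T2 (erefl (s * scale R T)%R).
  apply: (le_trans h); rewrite -/K1 /stockout_const -/K1 -/K2.
  by rewrite -[leLHS]mulr1 ler_pM// lerDl.
exists (fun=> T%:R), T%:R; split=> //.
- move=> w; apply: (@le_trans _ _ (\sum_(k < T) 1)%R).
    by apply: ler_sum => k _; case: stockout.
  by rewrite sumr_const card_ord.
- by rewrite integral_probability_cst.
(* A violated step-size condition bounds [scale], hence [sqrt T], by [K2]. The trivial count
   [T = sqrt T * sqrt T] is then at most [K2 * sqrt T]. *)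
have LK : (scale R T <= K2)%R.
  move: bad; rewrite negb_and -!ltNge alg_etaE.
  case/orP => [h|h].
    have : (scale R T * (W / 2) < abar)%R by rewrite -ltr_pdivlMl.
    have w1 : (1 <= W / 2)%R by lra.
    have := ler_wpM2l (ltW L0) w1; rewrite mulr1 => h1 h2.
    have : (0 <= G ^+ 2 / blow)%R by rewrite divr_ge0 ?sqr_ge0// ltW.
    by rewrite /K2; lra.
  have : (scale R T * blow < G ^+ 2)%R by rewrite -ltr_pdivlMl.
  rewrite -ltr_pdivlMr// => /ltW /le_trans; apply.
  by rewrite /K2 lerDl ltW.
rewrite -[leLHS](sqrt_sq R T) expr2 ler_wpM2r ?sqrtr_ge0//.
apply: (le_trans (sqrt_le_scale R T2)); apply: (le_trans LK).
by rewrite /stockout_const -/K1 -/K2 lerDr.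
Qed.

End BoundedRegret.

(** * Truncation to sure bounds *)

Definition clip {R : realType} (lo hi x : R) : R := Num.max lo (Num.min x hi).

Lemma clip_itv (R : realType) (lo hi x : R) : lo <= hi -> lo <= clip lo hi x <= hi.
Proof. by move=> lohi; rewrite le_max lexx ge_max lohi ge_min lexx orbT. Qed.

Lemma clip_id (R : realType) (lo hi x : R) : lo <= x <= hi -> clip lo hi x = x.
Proof. by move=> /andP[lox xhi]; rewrite /clip min_l// max_r. Qed.

Lemma measurable_clip (R : realType) (lo hi : R) : measurable_fun setT (clip lo hi).
Proof.
apply: measurable_maxr; first exact: measurable_cst.
by apply: measurable_minr => //; exact: measurable_cst.
Qed.

Lemma regret_ext (R : realType) m (rbar abar bbar blow C : R) T
    (r r' : nat -> R) (a a' b b' : nat -> 'I_m -> R) :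
  (forall t, (1 <= t <= T)%N -> [/\ r t = r' t, a t = a' t & b t = b' t]) ->
  hindsight_opt T r a b - alg_reward rbar abar bbar blow T C r a b =
  hindsight_opt T r' a' b' - alg_reward rbar abar bbar blow T C r' a' b'.
Proof.
move=> eqT.
have eqk (k : 'I_T) : [/\ r k.+1 = r' k.+1, a k.+1 = a' k.+1 & b k.+1 = b' k.+1].
  by apply: eqT; rewrite /= ltn_ord.
congr (_ - _).
  rewrite /hindsight_opt; apply: eq_big => [y|y _].
    congr asbool; rewrite /feasible; apply/propext.
    have aE (j : 'I_m) (t : 'I_T) : \sum_(k < T | (k <= t)%N) a k.+1 j * (y k)%:R =
        \sum_(k < T | (k <= t)%N) a' k.+1 j * (y k)%:R.
      by apply: eq_bigr => k _; have [_ -> _] := eqk k.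
    have bE (j : 'I_m) (t : 'I_T) : \sum_(k < T | (k <= t)%N) b k.+1 j =
        \sum_(k < T | (k <= t)%N) b' k.+1 j.
      by apply: eq_bigr => k _; have [_ _ ->] := eqk k.
    by split=> f j t; have := f j t; rewrite aE bE.
  by apply: eq_bigr => k _; have [-> _ _] := eqk k.
apply: eq_bigr => k _; have [rE aE bE] := eqk k; rewrite rE /alg_x /=.
rewrite (@alg_state_ext _ _ _ _ _ _ _ _ r r' a a' b b') => [|t /andP[t1 tk]]; last first.
  by apply: eqT; rewrite t1 (leq_trans tk)// ltnW.
by rewrite /alg_dec /inner rE aE.
Qed.

Lemma measurable_rect_event {d} {Omega : measurableType d} {R : realType} {m : nat}
    (r : Omega -> R) (a b : 'I_m -> Omega -> R) (A0 : set R) (A B : 'I_m -> set R) :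
  measurable_fun setT r -> (forall j, measurable_fun setT (a j)) ->
  (forall j, measurable_fun setT (b j)) -> measurable A0 ->
  (forall j, measurable (A j)) -> (forall j, measurable (B j)) ->
  measurable (rect_event r a b A0 A B).
Proof.
move=> mr ma mb mA0 mA mB.
pose Z (i : obs_index m) := match i with
  | None => A0 | Some (inl j) => A j | Some (inr j) => B j end.
have mZ i : measurable (Z i) by case: i => [[j|j]|]; [exact: mA|exact: mB|exact: mA0].
have := obs_preimage_box r a b Z; rewrite /= => <-.
rewrite -[X in measurable X]setTI; apply: (measurable_obs mr ma mb) => //.
exact: box_measurable.
Qed.

Section Truncation.
Local Open Scope ereal_scope.
Context {d d0 : measure_display} {Omega : measurableType d}
  {Omega0 : measurableType d0} {R : realType}.
Variables (P : probability Omega R) (P0 : probability Omega0 R) (m : nat).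
Variables (rbar abar bbar blow : R).
Hypotheses (rbar0 : (0 < rbar)%R) (abar0 : (0 < abar)%R) (bbar0 : (0 < bbar)%R).
Variables (r0 : Omega0 -> R) (a0 b0 : 'I_m -> Omega0 -> R).
Hypothesis bounded : bounded_draw P0 rbar abar bbar blow r0 a0 b0.

Definition in_range {D : Type} (r : D -> R) (a b : 'I_m -> D -> R) : set D :=
  rect_event r a b `[(- rbar)%R, rbar]%classic (fun=> `[(- abar)%R, abar]%classic)
    (fun=> `[0%R, bbar]%classic).

Lemma measurable_in_range d' (D : measurableType d') (r : D -> R)
    (a b : 'I_m -> D -> R) :
  measurable_fun setT r -> (forall j, measurable_fun setT (a j)) ->
  (forall j, measurable_fun setT (b j)) -> measurable (in_range r a b).
Proof.
by move=> mr ma mb; apply: measurable_rect_event => // *; exact: measurable_itv.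
Qed.

Lemma reference_in_range : P0 (~` in_range r0 a0 b0) = 0.
Proof.
have [[mr0 ma0 mb0] [b_ge0 [r_lt [a_lt [b_lt _]]]]] := bounded.
apply/negligibleP; first by apply: measurableC; exact: measurable_in_range.
suff : {ae P0, forall v, in_range r0 a0 b0 v} by [].
near=> v.
have bv0 : forall j, (0 <= b0 j v)%R by near: v; exact: b_ge0.
have rv : (`|r0 v| < rbar)%R by near: v; exact: r_lt.
have av : (Num.sqrt (\sum_(j < m) a0 j v ^+ 2) < abar)%R by near: v; exact: a_lt.
have bv : forall j, (`|b0 j v| < bbar)%R by near: v; exact: b_lt.
split; last split=> j /=.
- by rewrite /= in_itv /=; move: rv; rewrite ltr_norml => /andP[r1 r2]; rewrite !ltW.
- have : (`|a0 j v| <= Num.sqrt (\sum_(j < m) a0 j v ^+ 2))%R.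
    rewrite -sqrtr_sqr ler_wsqrtr// (bigD1 j)//= lerDl sumr_ge0// => i _.
    exact: sqr_ge0.
  by move=> /le_lt_trans/(_ av); rewrite ltr_norml in_itv /= => /andP[a1 a2]; rewrite !ltW.
- rewrite in_itv /= bv0 /=.
  by rewrite (le_trans (ler_norm _))// ltW.
Unshelve. all: by end_near.
Qed.

(** The almost sure bounds are given for the reference draw only; as the range is a rectangle event,
    [same_law] transports its full probability. *)
Lemma same_law_in_range (r : Omega -> R) (a b : 'I_m -> Omega -> R) :
  measurable_fun setT r -> (forall j, measurable_fun setT (a j)) ->
  (forall j, measurable_fun setT (b j)) -> same_law P P0 r a b r0 a0 b0 ->
  P (~` in_range r a b) = 0.
Proof.
move=> mr ma mb law; have [[mr0 ma0 mb0] _] := bounded.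
rewrite -reference_in_range !probability_setC; [|exact: measurable_in_range..].
by rewrite /in_range law// => *; exact: measurable_itv.
Qed.

Lemma clip_in_range {D : Type} (r : D -> R) (a b : 'I_m -> D -> R) v :
  in_range r a b v -> [/\ clip (- rbar) rbar (r v) = r v,
    (forall j, clip (- abar) abar (a j v) = a j v) &
    (forall j, clip 0 bbar (b j v) = b j v)].
Proof.
case=> rv [av bv]; split=> [|j|j]; apply: clip_id.
- by move: rv; rewrite /= in_itv.
- by have := av j; rewrite /= in_itv.
- by have := bv j; rewrite /= in_itv.
Qed.

Hypotheses (m_gt0 : (0 < m)%N) (blow0 : (0 < blow)%R).
Variable T : nat.
Hypothesis T2 : (2 <= T)%N.
Variables (r : nat -> Omega -> R) (a b : nat -> 'I_m -> Omega -> R).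
Hypotheses (mr : forall t, measurable_fun setT (r t))
  (ma : forall t j, measurable_fun setT (a t j))
  (mb : forall t j, measurable_fun setT (b t j)).
Hypothesis law : forall t, (1 <= t <= T)%N ->
  same_law P P0 (r t) (a t) (b t) r0 a0 b0.
Hypothesis indep : mutually_independent P T r a b.

(* All bounds hold almost surely only, so the draws are clipped to make them hold
   everywhere; clipping acts coordinatewise and thus preserves the common law and
   the independence, both of which quantify over product events. *)
Lemma expected_regret_bound :
  \int[P]_w (hindsight_opt T (fun t => r t w) (fun t j => a t j w) (fun t j => b t j w)
    - alg_reward rbar abar bbar blow T 9 (fun t => r t w) (fun t j => a t j w)
        (fun t j => b t j w))%:E
  <= (regret_const m rbar abar bbar blow * Num.sqrt T%:R * ln T%:R ^+ 1)%:E.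
Proof.
have [[mr0 ma0 mb0] [_ [_ [_ [_ bmean]]]]] := bounded.
pose cr : R -> R := clip (- rbar) rbar.
pose ca : R -> R := clip (- abar) abar.
pose cb : R -> R := clip 0 bbar.
have mcr : measurable_fun setT cr by exact: measurable_clip.
have mca : measurable_fun setT ca by exact: measurable_clip.
have mcb : measurable_fun setT cb by exact: measurable_clip.
pose r' t w := cr (r t w); pose a' t j w := ca (a t j w); pose b' t j w := cb (b t j w).
have mr' t : measurable_fun setT (r' t) by exact: measurableT_comp.
have ma' t j : measurable_fun setT (a' t j) by exact: measurableT_comp.
have mb' t j : measurable_fun setT (b' t j) by exact: measurableT_comp.
have preim (c : R -> R) (A : set R) : measurable_fun setT c -> measurable A ->
    measurable (c @^-1` A).
  by move=> mc mA; rewrite -[X in measurable X]setTI; exact: mc.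
have law' t : (1 <= t <= T)%N ->
    same_law P P0 (r' t) (a' t) (b' t) (cr \o r0) (fun j => ca \o a0 j)
      (fun j => cb \o b0 j).
  move=> tT A0 A B mA0 mA mB.
  exact: (law tT (preim _ _ mcr mA0) (fun j => preim _ _ mca (mA j))
    (fun j => preim _ _ mcb (mB j))).
have indep' : mutually_independent P T r' a' b'.
  move=> S A0 A B mA0 mA mB.
  exact: (indep S (fun t => preim _ _ mcr (mA0 t)) (fun t j => preim _ _ mca (mA t j))
    (fun t j => preim _ _ mcb (mB t j))).
have cr_bd x : (`|cr x| <= rbar)%R.
  by rewrite ler_norml clip_itv// ge0_cp// ltW.
have ca_bd x : (`|ca x| <= abar)%R.
  by rewrite ler_norml clip_itv// ge0_cp// ltW.
have cb_bd x : (0 <= cb x <= bbar)%R by rewrite clip_itv// ltW.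
have bmean' j : blow%:E <= \int[P0]_v ((cb \o b0 j) v)%:E.
  rewrite (ae_eq_integral (fun v => (b0 j v)%:E))//; first exact: ltW.
  - by apply/measurable_EFinP; exact: measurableT_comp.
  - exact/measurable_EFinP.
  exists (~` in_range r0 a0 b0); split.
  - by apply: measurableC; exact: measurable_in_range.
  - exact: reference_in_range.
  apply: subsetC => v vr _ /=; have [_ _ bv] := clip_in_range vr.
  by congr EFin; exact: bv.
have regretE : \int[P]_w (hindsight_opt T (fun t => r t w) (fun t j => a t j w)
      (fun t j => b t j w)
    - alg_reward rbar abar bbar blow T 9 (fun t => r t w) (fun t j => a t j w)
        (fun t j => b t j w))%:E =
    \int[P]_w (hindsight_opt T (fun t => r' t w) (fun t j => a' t j w)
      (fun t j => b' t j w)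
    - alg_reward rbar abar bbar blow T 9 (fun t => r' t w) (fun t j => a' t j w)
        (fun t j => b' t j w))%:E.
  apply: ae_eq_integral => //.
  - apply/measurable_EFinP; apply: measurable_funB; first exact: measurable_hindsight_opt.
    exact: measurable_alg_reward.
  - apply/measurable_EFinP; apply: measurable_funB; first exact: measurable_hindsight_opt.
    exact: measurable_alg_reward.
  (* The common law is known up to period [T] only, so later indices contribute the empty set to the
     countable union of negligible sets. *)
  pose bad k := if (k < T)%N then ~` in_range (r k.+1) (a k.+1) (b k.+1) else set0.
  have badN k : P.-negligible (bad k).
    rewrite /bad; case: ifP => kT; last exact: negligible_set0.
    apply/negligibleP; first by apply: measurableC; exact: measurable_in_range.
    by apply: same_law_in_range => //; apply: law; rewrite /= kT.
  apply: negligibleS (negligible_bigcup badN).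
  rewrite -[X in _ `<=` X]setCK; apply: subsetC => w goodw _.
  have good k : (k < T)%N -> in_range (r k.+1) (a k.+1) (b k.+1) w.
    move=> kT; apply: contrapT => nin; apply: goodw; exists k => //.
    by rewrite /bad kT.
  congr EFin; apply: regret_ext => -[//|t] /= tT.
  have [rv av bv] := clip_in_range (good t tT).
  split; [exact/esym|apply/funext => j; apply/esym; exact: av|].
  by apply/funext => j; apply/esym; exact: bv.
rewrite regretE.
exact: (bounded_regret m_gt0 rbar0 abar0 bbar0 blow0 mr' ma' mb'
  (measurableT_comp mcr mr0) (fun j => measurableT_comp mca (ma0 j))
  (fun j => measurableT_comp mcb (mb0 j)) (fun t w => cr_bd _) (fun t j w => ca_bd _)
  (fun t j w => cb_bd _) (fun v => cr_bd _) (fun j v => cb_bd _) bmean' law' indep' T2).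
Qed.

End Truncation.

Theorem theorem1 (R : realType) (m : nat) (rbar abar bbar blow : R) :
  (0 < m)%N -> 0 < rbar -> 0 < abar -> 0 < bbar -> 0 < blow ->
  (* feasibility: for every realization (b >= 0), every horizon T *)
  (forall (T : nat) (r : nat -> R) (a b : nat -> 'I_m -> R),
      (forall t j, 0 <= b t j) ->
      alg_feasible rbar abar bbar blow T 9 r a b)
  /\
  (* regret bound: fix a bounded distribution, given as the law of a reference
     draw (r0, a0, b0) on (Omega0, P0) *)
  (forall (d0 : measure_display) (Omega0 : measurableType d0)
          (P0 : probability Omega0 R)
          (r0 : Omega0 -> R) (a0 b0 : 'I_m -> Omega0 -> R),
      bounded_draw P0 rbar abar bbar blow r0 a0 b0 ->
      exists (K : R) (c : nat), forall T : nat, (2 <= T)%N ->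
        forall (d : measure_display) (Omega : measurableType d)
               (P : probability Omega R)
               (r : nat -> Omega -> R) (a b : nat -> 'I_m -> Omega -> R),
          (forall t, measurable_fun setT (r t)) ->
          (forall t j, measurable_fun setT (a t j)) ->
          (forall t j, measurable_fun setT (b t j)) ->
          (forall t, (1 <= t <= T)%N ->
             same_law P P0 (r t) (a t) (b t) r0 a0 b0) ->
          mutually_independent P T r a b ->
          (\int[P]_w
             ((hindsight_opt T (fun t => r t w) (fun t j => a t j w)
                               (fun t j => b t j w)
               - alg_reward rbar abar bbar blow T 9
                   (fun t => r t w) (fun t j => a t j w) (fun t j => b t j w))%:E)
           <= (K * Num.sqrt T%:R * ln T%:R ^+ c)%:E)%E).

Proof.
move=> m_gt0 rbar0 abar0 bbar0 blow0; split=> [T r a b b_ge0|].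
  by apply: algorithm_feasible => //; apply: le_trans (alg_W_ge2 _ _ _ _ _).
move=> d0 Omega0 P0 r0 a0 b0 bounded.
exists (regret_const m rbar abar bbar blow), 1%N.
move=> T T2 d Omega P r a b mr ma mb law indep.
exact: (expected_regret_bound rbar0 abar0 bbar0 bounded m_gt0 blow0 T2 mr ma mb law indep).
Qed.
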